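(* Let $A$ and $B$ be C$^*$-algebras of stable rank one all of whose hereditary C$^*$-subalgebras are $\sigma$-unital. Let $X_1, Y_1$ be countably generated Hilbert $A$-modules and $X_2, Y_2$ countably generated Hilbert $B$-modules. If $Y_1 \subset\subset X_1$ and $Y_2 \subset\subset X_2$, then $Y_1 \otimes Y_2 \subset\subset X_1 \otimes X_2$ as Hilbert $A\otimes B$-modules.
   Context: Compact containment: for countably generated Hilbert C$^*$-modules $X$ and $Y$ over the same C$^*$-algebra, with $X$ a (closed) Hilbert submodule of $Y$, one writes $X \subset\subset Y$ (''$X$ is compactly contained in $Y$'') if there is a compact self-adjoint endomorphism $b$ of $Y$ which acts as the identity on $X$, i.e. $b x = x$ for all $x\in X$. Here a compact endomorphism of $Y$ is an element of $\mathcal{K}(Y)$, the norm-closed linear span of the operators $z \mapsto y\langle y', z\rangle$, $y,y'\in Y$. Tensor products: $A\otimes B$ denotes the minimal (spatial) C$^*$-tensor product. For a Hilbert $A$-module $X$ and a Hilbert $B$-module $Y$, the external tensor product $X\otimes Y$ is the Hilbert $A\otimes B$-module obtained by completing the algebraic tensor product $X\odot Y$ with respect to the norm induced by the $A\otimes B$-valued inner product $\langle x_1\otimes y_1, x_2\otimes y_2\rangle = \langle x_1,x_2\rangle\otimes\langle y_1,y_2\rangle$. If $Y_1\subseteq X_1$ and $Y_2\subseteq X_2$ are Hilbert submodules, $Y_1\otimes Y_2$ is regarded as a Hilbert submodule of $X_1\otimes X_2$. *)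

(* Defs.v *)
From HB Require Import structures.
From mathcomp Require Import all_boot all_order all_algebra.
From mathcomp Require Import all_classical all_reals all_analysis.
From mathcomp Require Import complex.

Set Implicit Arguments.
Unset Strict Implicit.
Unset Printing Implicit Defensive.

Import Order.TTheory GRing.Theory Num.Theory.
Import numFieldNormedType.Exports.

Local Open Scope classical_set_scope.
Local Open Scope ring_scope.

(* Norms on normed modules over R[i] take values in the nonnegative reals of
   R[i]; an inequality 0 < e in R[i] entails that e is real. *)

(* MathComp rings are unital, whereas C*-algebras need not be: the product is
   therefore introduced together with the involution. *)
HB.mixin Record isCStarAlgebra (R : realType) A
    of CompleteNormedModule R[i] A := {
  amul : A -> A -> A;
  star : A -> A;
  amulA : forall a b c, amul a (amul b c) = amul (amul a b) c;
  amulDl : forall a b c, amul (a + b) c = amul a c + amul b c;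
  amulDr : forall a b c, amul a (b + c) = amul a b + amul a c;
  amulZl : forall (k : R[i]) a b, amul (k *: a) b = k *: amul a b;
  amulZr : forall (k : R[i]) a b, amul a (k *: b) = k *: amul a b;
  starK : forall a, star (star a) = a;
  starD : forall a b, star (a + b) = star a + star b;
  starZ : forall (k : R[i]) a, star (k *: a) = k^* *: star a;
  starM : forall a b, star (amul a b) = amul (star b) (star a);
  normA_mul : forall a b, `|amul a b| <= `|a| * `|b|;
  cstar_id : forall a, `|amul (star a) a| = `|a| ^+ 2
}.

#[short(type="cstarType")]
HB.structure Definition CStarAlgebra (R : realType) :=
  {A of isCStarAlgebra R A & CompleteNormedModule R[i] A}.

Reserved Notation "a ** b" (at level 40, left associativity).
Notation "a ** b" := (amul a b) : ring_scope.

Section CStarAlgebraTheory.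
Context {R : realType} {A : cstarType R}.
Implicit Types (a b u : A) (S : set A) (x y : A * R[i]).

Definition positive a := exists b, a = star b ** b.

Definition is_unit_element u := forall a, u ** a = a /\ a ** u = a.

Definition ainvertible a :=
  exists u, is_unit_element u /\ exists b, a ** b = u /\ b ** a = u.

(* The unitization is A * R[i] with (a, k)(b, l) = (ab + k b + l a, k l) and
   unit (0, 1). *)
Definition unitization_mul x y : A * R[i] :=
  (x.1 ** y.1 + x.2 *: y.1 + y.2 *: x.1, x.2 * y.2).

Definition unitization_invertible x :=
  exists y, unitization_mul x y = (0, 1) /\ unitization_mul y x = (0, 1).

(* The norm of the unitization of a nonunital A is the norm of the operator
   b |-> a b + k b on A. *)
Definition unitization_norm_le x (e : R[i]) :=
  forall b, `|x.1 ** b + x.2 *: b| <= e * `|b|.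

Definition stable_rank_one_unital := dense [set a | ainvertible a].

Definition stable_rank_one_nonunital :=
  forall x (e : R[i]), 0 < e ->
    exists y, unitization_invertible y /\ unitization_norm_le (x - y) e.

Definition csubalgebra S :=
  [/\ closed S,
      S 0 /\ (forall a b, S a -> S b -> S (a + b)),
      forall (k : R[i]) a, S a -> S (k *: a),
      forall a b, S a -> S b -> S (a ** b) &
      forall a, S a -> S (star a)].

Definition hereditary S :=
  csubalgebra S /\
  forall a b, S b -> positive a -> positive (b - a) -> S a.

(* S has a sequential approximate unit; as S is stable under the involution,
   the limit on one side gives the limit on the other. *)
Definition sigma_unital S :=
  exists e : nat -> A,
    [/\ forall n, S (e n) /\ positive (e n),
        forall n, `|e n| <= 1,
        forall n, positive (e n.+1 - e n) &
        forall a, S a -> e n ** a @[n --> \oo] --> a].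

End CStarAlgebraTheory.

Definition stable_rank_one (R : realType) (A : cstarType R) :=
  ((exists u : A, is_unit_element u) -> @stable_rank_one_unital R A) /\
  (~ (exists u : A, is_unit_element u) -> @stable_rank_one_nonunital R A).

Definition hereditary_sigma_unital (R : realType) (A : cstarType R) :=
  forall S : set A, hereditary S -> sigma_unital S.

(* Right modules, with inner product linear in the second variable. *)
HB.mixin Record isHilbertModule (R : realType) (A : cstarType R) X
    of CompleteNormedModule R[i] X := {
  ract : X -> A -> X;
  hinner : X -> X -> A;
  ractDl : forall x y a, ract (x + y) a = ract x a + ract y a;
  ractDr : forall x a b, ract x (a + b) = ract x a + ract x b;
  ractZl : forall (k : R[i]) x a, ract (k *: x) a = k *: ract x a;
  ractZr : forall (k : R[i]) x a, ract x (k *: a) = k *: ract x a;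
  ractM : forall x a b, ract x (a ** b) = ract (ract x a) b;
  hinnerDr : forall x y z, hinner x (y + z) = hinner x y + hinner x z;
  hinnerZr : forall (k : R[i]) x y, hinner x (k *: y) = k *: hinner x y;
  hinner_ract : forall x y a, hinner x (ract y a) = hinner x y ** a;
  hinnerC : forall x y, hinner y x = star (hinner x y);
  hinner_ge0 : forall x, positive (hinner x x);
  norm_hinner : forall x, `|x| ^+ 2 = `|hinner x x|
}.

#[short(type="hilbertModType")]
HB.structure Definition HilbertModule (R : realType) (A : cstarType R) :=
  {X of isHilbertModule R A X & CompleteNormedModule R[i] X}.

Section HilbertModuleTheory.
Context {R : realType} {A : cstarType R} {X : hilbertModType A}.
Implicit Types (Y : set X) (b : X -> X).

Definition hilbert_submodule Y :=
  [/\ closed Y,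
      Y 0 /\ (forall x y, Y x -> Y y -> Y (x + y)),
      forall (k : R[i]) x, Y x -> Y (k *: x) &
      forall x (a : A), Y x -> Y (ract x a)].

(* Y is the smallest closed submodule containing some sequence of elements. *)
Definition countably_generated Y :=
  exists x : nat -> X, range x `<=` Y /\
    forall Z, hilbert_submodule Z -> range x `<=` Z -> Y `<=` Z.

Definition adjointable b :=
  exists b' : X -> X, forall x y, hinner (b x) y = hinner x (b' y) :> A.

Definition self_adjoint b :=
  forall x y, hinner (b x) y = hinner x (b y) :> A.

Definition rank_one (y y' z : X) : X := ract y (hinner y' z : A).

(* Closure, for the operator norm, of the linear span of the rank_one y y'. *)
Definition compact_endomorphism b :=
  adjointable b /\
  forall e : R[i], 0 < e ->
    exists (n : nat) (k : 'I_n -> R[i]) (y y' : 'I_n -> X), forall z,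
      `|b z - \sum_(i < n) k i *: rank_one (y i) (y' i) z| <= e * `|z|.

(* The relation Y << X between countably generated modules, X being the ambient
   module. *)
Definition compactly_contained Y :=
  [/\ hilbert_submodule Y, countably_generated Y,
      countably_generated [set: X] &
      exists b, [/\ compact_endomorphism b, self_adjoint b &
                    forall x, Y x -> b x = x]].

End HilbertModuleTheory.

HB.mixin Record isHilbertSpace (R : realType) H
    of CompleteNormedModule R[i] H := {
  hdot : H -> H -> R[i];
  hdotDr : forall x y z, hdot x (y + z) = hdot x y + hdot x z;
  hdotZr : forall (k : R[i]) x y, hdot x (k *: y) = k * hdot x y;
  hdotC : forall x y, hdot y x = (hdot x y)^*;
  norm_hdot : forall x, `|x| ^+ 2 = hdot x x
}.

#[short(type="hilbertSpaceType")]
HB.structure Definition HilbertSpace (R : realType) :=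
  {H of isHilbertSpace R H & CompleteNormedModule R[i] H}.

Section Representation.
Context {R : realType} {A : cstarType R} {H : hilbertSpaceType R}.

Definition representation (pi : A -> {linear H -> H}) :=
  [/\ forall a, continuous (pi a),
      forall (k : R[i]) a b h, pi (k *: a + b) h = k *: pi a h + pi b h,
      forall a b h, pi (a ** b) h = pi a (pi b h) &
      forall a h h', hdot (pi a h) h' = hdot h (pi (star a) h')].

Definition faithful_representation (pi : A -> {linear H -> H}) :=
  representation pi /\ forall a b, pi a =1 pi b -> a = b.

End Representation.

(* Finite sums of elementary tensors; when S and T are linear subspaces this is
   the image of their algebraic tensor product. *)
Definition tensor_span (U V : Type) (W : zmodType) (f : U -> V -> W)
    (S : set U) (T : set V) : set W :=
  [set w | exists (n : nat) (u : 'I_n -> U) (v : 'I_n -> V),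
     (forall i, S (u i) /\ T (v i)) /\ w = \sum_(i < n) f (u i) (v i)].

Definition hilbert_space_tensor (R : realType) (H K L : hilbertSpaceType R)
    (f : H -> K -> L) :=
  [/\ bilinear_for *:%R *:%R f,
      forall h h' k k', hdot (f h k) (f h' k') = hdot h h' * hdot k k' &
      dense (tensor_span f [set: H] [set: K])].

(* (AB, t) is a spatial tensor product of A and B, t a b being a (x) b: AB is
   the completion of the *-algebra generated by the t a b, normed through
   operators pi a (x) sigma b on a Hilbert space tensor product H (x) K, for
   some faithful pi and sigma; the norm does not depend on this choice. The
   representation rho, being faithful, is isometric. *)
Definition minimal_tensor (R : realType) (A B AB : cstarType R)
    (t : A -> B -> AB) :=
  [/\ bilinear_for *:%R *:%R t,
      forall a a' b b', t a b ** t a' b' = t (a ** a') (b ** b'),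
      forall a b, star (t a b) = t (star a) (star b),
      dense (tensor_span t [set: A] [set: B]) &
      exists (H K L : hilbertSpaceType R) (f : H -> K -> L)
             (pi : A -> {linear H -> H}) (sigma : B -> {linear K -> K})
             (rho : AB -> {linear L -> L}),
        [/\ hilbert_space_tensor f, faithful_representation pi,
            faithful_representation sigma, faithful_representation rho &
            forall a b h k, rho (t a b) (f h k) = f (pi a h) (sigma b k)]].

Section ExternalTensor.
Context {R : realType} {A B AB : cstarType R}.
Context {X1 : hilbertModType A} {X2 : hilbertModType B}.
Context {X : hilbertModType AB}.

(* (X, f) is a completion of the algebraic tensor product of X1 and X2 for the
   inner product with values in (AB, t), f x1 x2 being x1 (x) x2. *)
Definition external_tensor (t : A -> B -> AB) (f : X1 -> X2 -> X) :=
  [/\ bilinear_for *:%R *:%R f,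
      forall x1 x2 (a : A) (b : B),
        ract (f x1 x2) (t a b) = f (ract x1 a) (ract x2 b),
      forall x1 x1' x2 x2',
        hinner (f x1 x2) (f x1' x2') = t (hinner x1 x1') (hinner x2 x2') &
      dense (tensor_span f [set: X1] [set: X2])].

Definition tensor_submodule (f : X1 -> X2 -> X) (Y1 : set X1) (Y2 : set X2) :
  set X := closure (tensor_span f Y1 Y2).

End ExternalTensor.

(* Main.v *)
(* If b1 and b2 are compact self-adjoint and fix Y1 and Y2, then b1 (x) b2 fixes
   Y1 (x) Y2; it is obtained as the norm limit of the finite rank operators
   F1 n (x) F2 n, where F1 n -> b1 and F2 n -> b2. The limit exists because
   |T1 (x) T2| is at most a constant times |T1| |T2| on the algebraic tensor
   product: with S = T1* T1 (x) T2* T2, the inequality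
   |S^n z|^2 = |<z, S^(2n) z>| <= const |z| |S^(2n) z|, iterated along powers of
   two, reduces the bound to the obvious geometric growth of |S^n z|.
   This needs |a (x) b| <= const |a| |b| in A (x) B, which follows from the closed
   graph theorem. Sequential approximate units of A and B show that the products
   of generators of Y1 and Y2 generate Y1 (x) Y2. *)
Require Import Defs.
From mathcomp Require Import all_boot all_order all_algebra.
From mathcomp Require Import all_classical all_reals all_analysis.
From mathcomp Require Import complex.
From mathcomp Require Import ring lra.

Set Implicit Arguments.
Unset Strict Implicit.
Unset Printing Implicit Defensive.

Import Order.TTheory GRing.Theory Num.Theory.
Import numFieldNormedType.Exports.

Local Open Scope classical_set_scope.
Local Open Scope complex_scope.
Local Open Scope ring_scope.

(** * Real-valued norms *)

(** No spectral theory is developed, and this shapes the constants. Square roots come from a fixed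
    point iteration, so representations are bounded by 2 instead of 1; Cauchy-Schwarz comes from
    polarization, with a factor 4; adjoints and operator tensor products inherit such factors. Every
    use tolerates a fixed constant. The tensor product of two operators is never extended by
    completion: for finite rank operators an explicit formula defines it on the whole module, and
    the norm estimate on elementary sums serves to compare two such formulas. The family version of
    the closed graph theorem includes uniform boundedness, which turns separate bounds on [t a] and
    [t^~ b] into a joint one. Norms are moved from [R[i]] to [R], where the order is total and real
    arithmetic applies. *)

Definition rnorm (R : realType) (V : normedModType R[i]) (x : V) : R :=
  complex.Re (`|x| : R[i]).

Section RealNorm.
Context {R : realType}.
Implicit Types V : normedModType R[i].

Lemma rnormE V (x : V) : `|x| = (rnorm x)%:C.
Proof. by rewrite /rnorm RRe_real// ger0_real. Qed.

Lemma rnorm_ge0 V (x : V) : 0 <= rnorm x.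
Proof. by rewrite -lecR -rnormE normr_ge0. Qed.

Lemma rnorm0 V : rnorm (0 : V) = 0.
Proof. by rewrite /rnorm normr0. Qed.

Lemma rnorm0_eq0 V (x : V) : rnorm x = 0 -> x = 0.
Proof. by move=> x0; apply/normr0_eq0; rewrite rnormE x0. Qed.

Lemma rnormN V (x : V) : rnorm (- x) = rnorm x.
Proof. by rewrite /rnorm normrN. Qed.

Lemma rnormD V (x y : V) : rnorm (x + y) <= rnorm x + rnorm y.
Proof. by rewrite -lecR rmorphD/= -!rnormE ler_normD. Qed.

Lemma rnormB V (x y : V) : rnorm (x - y) <= rnorm x + rnorm y.
Proof. by rewrite -(rnormN y) rnormD. Qed.

Lemma rdistC V (x y : V) : rnorm (x - y) = rnorm (y - x).
Proof. by rewrite -rnormN opprB. Qed.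

Lemma rdistD V (z x y : V) : rnorm (x - y) <= rnorm (x - z) + rnorm (z - y).
Proof. by rewrite (le_trans _ (rnormD _ _))// addrA subrK. Qed.

Lemma rnormZ V (k : R[i]) (x : V) : rnorm (k *: x) = complex.Re `|k| * rnorm x.
Proof.
have : (complex.Re `|k|)%:C = `|k| by rewrite RRe_real// ger0_real.
move: (complex.Re _) => r rE.
by apply: complexI; rewrite -rnormE normrZ rmorphM/= -rnormE rE.
Qed.

Lemma rnormZr V (k : R) (x : V) : rnorm (k%:C *: x) = `|k| * rnorm x.
Proof.
by rewrite rnormZ normc_def/= expr0n/= addr0 sqrtr_sqr.
Qed.

Lemma rnorm_sum V (I : Type) (r : seq I) (P : pred I) (F : I -> V) :
  rnorm (\sum_(i <- r | P i) F i) <= \sum_(i <- r | P i) rnorm (F i).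
Proof.
elim/big_ind2 : _ => //; first by rewrite rnorm0.
by move=> x a y b xa yb; exact: le_trans (rnormD _ _) (lerD xa yb).
Qed.

(** Identities between limits are proved in this form: each approximation step costs a multiple of
    [e], and the multiples are collected in a [C] fixed beforehand, of any sign. *)
Lemma rnorm_small0 V (x : V) (C : R) :
  (forall e, 0 < e -> rnorm x <= C * e) -> x = 0.
Proof.
move=> h; apply: rnorm0_eq0; apply/eqP; rewrite eq_le rnorm_ge0 andbT.
have C1 : 0 < `|C| + 1 by rewrite ltr_wpDl.
apply/ler_addgt0Pr => e e0; rewrite add0r.
apply: le_trans (h (e / (`|C| + 1)) _) _; first by rewrite divr_gt0.
rewrite mulrCA ler_piMr ?(ltW e0)// ler_pdivrMr// mul1r.
by rewrite (le_trans (ler_norm _))// lerDl.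
Qed.

Lemma nbhs_rnorm V (x : V) (B : set V) :
  nbhs x B <-> exists2 e : R, 0 < e & forall y, rnorm (x - y) < e -> B y.
Proof.
split.
  move=> /nbhs_normP[e /= e0 eB].
  have er : e = (complex.Re e)%:C by rewrite RRe_real// gtr0_real.
  exists (complex.Re e); first by rewrite -ltcR -er.
  by move=> y xy; apply: eB; rewrite /= rnormE er ltcR.
move=> [e e0 eB]; apply/nbhs_normP; exists e%:C; first by rewrite /= ltcR.
by move=> y /=; rewrite rnormE ltcR; exact: eB.
Qed.

Lemma closure_rnorm V (S : set V) (x : V) :
  closure S x <-> forall e : R, 0 < e -> exists2 s, S s & rnorm (x - s) < e.
Proof.
split=> [cl e e0|h B /nbhs_rnorm[e e0 eB]].
  have /cl[s [Ss xs]] : nbhs x [set y | rnorm (x - y) < e].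
    by apply/nbhs_rnorm; exists e.
  by exists s.
by have [s Ss /eB Bs] := h _ e0; exists s.
Qed.

Lemma closed_rnorm V (S : set V) :
  closed S <->
  forall x, (forall e : R, 0 < e -> exists2 s, S s & rnorm (x - s) < e) -> S x.
Proof.
split=> [cl x /closure_rnorm|h x /closure_rnorm]; [exact: cl|exact: h].
Qed.

Lemma dense_rnorm V (S : set V) : dense S ->
  forall (x : V) (e : R), 0 < e -> exists2 s, S s & rnorm (x - s) < e.
Proof.
move=> dS x e e0; have : nbhs x [set y | rnorm (x - y) < e].
  by apply/nbhs_rnorm; exists e.
rewrite nbhsE => -[U [openU Ux] sub].
have [s [Us Ss]] := dS U (ex_intro _ _ Ux) openU.
by exists s => //; exact: sub.
Qed.

Lemma exists_half_exp (K e : R) : 0 < e -> exists n, K * 2^-1 ^+ n < e.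
Proof.
move=> e0; have [K0|K0] := leP K 0.
  by exists 0%N; rewrite expr0 mulr1 (le_lt_trans K0).
have /cvgrPdist_lt/(_ _ (divr_gt0 e0 K0))[N _ /(_ N (leqnn N))] :
  2^-1 ^+ n @[n --> \oo] --> (0 : R) by apply: cvg_expr; rewrite gtr0_norm; lra.
rewrite /= sub0r normrN ger0_norm ?exprn_ge0// => h.
by exists N; rewrite mulrC -ltr_pdivlMr.
Qed.

End RealNorm.

Lemma geometric_cvg (R : realType) (V : completeNormedModType R[i])
    (u : nat -> V) (K : R) :
  (forall n, rnorm (u n.+1 - u n) <= K * 2^-1 ^+ n) ->
  exists l, forall n, rnorm (u n - l) <= K * 2 * 2^-1 ^+ n.
Proof.
move=> h.
have K0 : 0 <= K by have := h 0%N; rewrite expr0 mulr1; apply: le_trans (rnorm_ge0 _).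
(* The induction carries the exact partial geometric sum; the bare bound [K * 2 * 2^-1 ^+ n] would
   not reproduce itself. *)
have tail n m : rnorm (u (n + m)%N - u n) <= K * 2 * (2^-1 ^+ n - 2^-1 ^+ (n + m)).
  elim: m => [|m ih]; first by rewrite addn0 !subrr rnorm0 mulr0.
  rewrite (le_trans (rdistD (u (n + m)%N) _ _))// addnS.
  rewrite (le_trans (lerD (h _) ih))// exprS.
  by rewrite [leLHS](_ : _ = K * 2 * (2^-1 ^+ n - 2^-1 * 2^-1 ^+ (n + m)))//; field.
have tail' n m : (n <= m)%N -> rnorm (u m - u n) <= K * 2 * 2^-1 ^+ n.
  move=> /subnKC <-; apply: le_trans (tail n _) _.
  by rewrite ler_wpM2l ?mulr_ge0// gerBl exprn_ge0.
have /cauchy_cvgP : cauchy (u n @[n --> \oo]).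
  apply/cauchyP => /= e e0.
  have er : e = (complex.Re e)%:C by rewrite RRe_real// gtr0_real.
  have e0' : 0 < complex.Re e by rewrite -ltcR -er.
  have [N HN] := exists_half_exp (K * 2) e0'.
  exists (u N), N => // m /= Nm.
  rewrite -ball_normE /= rnormE er ltcR rdistC.
  exact: le_lt_trans (tail' _ _ Nm) HN.
move=> /cvg_ex[l ul]; exists l => n.
apply/ler_addgt0Pr => e e0.
have /ul[N _ HN] : nbhs l [set y | rnorm (l - y) < e].
  by apply/nbhs_rnorm; exists e.
have := HN (maxn n N) (leq_maxr _ _) => /= lt.
rewrite (le_trans (rdistD (u (maxn n N)) _ _))// lerD//.
  by rewrite rdistC tail'// leq_maxl.
by rewrite rdistC ltW.
Qed.

(** * The closed graph theorem for families of linear maps *)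

Section ClosedGraph.
Context {R : realType} {V : completeNormedModType R[i]}.

(** Baire's argument by nested balls: if no closure contains a ball, each ball contains one of at
    most half the radius that misses [S n], and the limit of the centres lies in no [S n]. *)
Lemma baire_cover (S : nat -> set V) : (forall x, exists n, S n x) ->
  exists n x0 (r : R), 0 < r /\
    forall x, rnorm (x - x0) < r -> closure (S n) x.
Proof.
move=> cover; apply: contrapT => nowhere.
(* The premise on the radius sits under the existential so that choice gives a total function;
   [(0, 0)] is the dummy value for nonpositive radii. *)
have step (np : nat * (V * R)) : exists q : V * R, 0 < np.2.2 ->
    [/\ 0 < q.2, rnorm (q.1 - np.2.1) <= np.2.2 / 2, q.2 <= np.2.2 / 2 &
        forall s, S np.1 s -> q.2 < rnorm (q.1 - s)].
  case: np => n [x0 r] /=; have [r0|] := ltP 0 r; last by exists (0, 0).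
  apply: contrapT => nq; apply: nowhere; exists n, x0, (r / 2); split.
    by rewrite divr_gt0.
  move=> x xx0; apply/closure_rnorm => e e0; apply: contrapT => ns.
  apply: nq; exists (x, Num.min (r / 2) (e / 2)) => _ /=; split.
  - by rewrite lt_min !divr_gt0.
  - exact: ltW.
  - by rewrite ge_min lexx.
  - move=> s Ss; rewrite gt_min; apply/orP; right; rewrite ltNge.
    apply/negP => h; apply: ns; exists s => //; apply: le_lt_trans h _; lra.
have [nx nxP] := choice step.
pose u := fix u n := if n is n'.+1 then nx (n', u n') else ((0, 1) : V * R).
have u0 n : 0 < (u n).2.
  by elim: n => [|n ih] //=; have [] := nxP (n, u n) ih.
have uS n : [/\ rnorm ((u n.+1).1 - (u n).1) <= (u n).2 / 2,
    (u n.+1).2 <= (u n).2 / 2 &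
    forall s, S n s -> (u n.+1).2 < rnorm ((u n.+1).1 - s)].
  by have [] := nxP (n, u n) (u0 n).
have ub n : (u n).2 <= 2^-1 ^+ n.
  elim: n => [|n ih] //; have [_ h _] := uS n.
  by rewrite (le_trans h)// exprS mulrC ler_wpM2l.
have [|l lP] := @geometric_cvg _ V (fun n => (u n).1) 1.
  move=> n; rewrite mul1r; have [h _ _] := uS n; apply: le_trans h _.
  apply: le_trans (ub n); have := u0 n; lra.
(* Nestedness of the balls: centres move by at most the loss of radius, so the limit stays in every
   closed ball. *)
have tail n m : rnorm ((u (n + m)%N).1 - (u n).1) <= (u n).2 - (u (n + m)%N).2.
  elim: m => [|m ih]; first by rewrite addn0 !subrr rnorm0.
  rewrite addnS; have [h1 h2 _] := uS (n + m)%N.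
  rewrite (le_trans (rdistD (u (n + m)%N).1 _ _))//; lra.
have near_l n : rnorm ((u n).1 - l) <= (u n).2.
  apply/ler_addgt0Pr => e e0.
  have [m mP] := exists_half_exp 2 e0.
  have /= h := lP (n + m)%N; have := tail n m; have := u0 (n + m)%N.
  have : 2^-1 ^+ (n + m) <= 2^-1 ^+ m :> R.
    by rewrite exprD ler_piMl ?exprn_ge0// exprn_ile1//; lra.
  have := rdistD (u (n + m)%N).1 (u n).1 l.
  rewrite (rdistC (u n).1 (u (n + m)%N).1); lra.
have [n Snl] := cover l; have [_ _ /(_ _ Snl)] := uS n.
by rewrite ltNge near_l.
Qed.

Context {W : completeNormedModType R[i]} {I : Type} (F : I -> V -> W).
Hypothesis F_linear :
  forall i (k : R[i]) x y, F i (k *: x + y) = k *: F i x + F i y.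
Hypothesis F_closed : forall i g,
  (forall e : R, 0 < e -> exists x, rnorm x < e /\ rnorm (F i x - g) < e) ->
  g = 0.
Hypothesis F_pointwise : forall x, exists M : R, forall i, rnorm (F i x) <= M.

Let FD i x y : F i (x + y) = F i x + F i y.
Proof. by have := F_linear i 1 x y; rewrite !scale1r. Qed.

Let F0 i : F i 0 = 0.
Proof. by apply: (@addrI _ (F i 0)); rewrite -FD !addr0. Qed.

Let FZ i k x : F i (k *: x) = k *: F i x.
Proof. by have := F_linear i k x 0; rewrite F0 !addr0. Qed.

Let FB i x y : F i (x - y) = F i x - F i y.
Proof. by rewrite -scaleN1r FD FZ scaleN1r. Qed.

(** Baire applied to the sets where all [F i] are bounded by [n] gives a ball around some [x0] in
    one closure. A multiple of [x] is then approximated by a difference of two points of that set,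
    near [x0 + k x] and [x0]. *)
Lemma closed_graph_approx : exists2 C : R, 0 <= C & forall x (e : R), 0 < e ->
  exists y, rnorm (x - y) < e /\ forall i, rnorm (F i y) <= C * rnorm x.
Proof.
have [|n [x0 [r [r0 ball]]]] :=
    @baire_cover (fun n => [set x | forall i, rnorm (F i x) <= n%:R]).
  move=> x; have [M MP] := F_pointwise x.
  exists (Num.truncn `|M|).+1 => i /=; apply: le_trans (MP i) _.
  by rewrite (le_trans (ler_norm _))// ltW// truncnS_gt.
exists (4 * n%:R / r) => [|x e e0]; first by rewrite divr_ge0 ?mulr_ge0// ltW.
have [x0'|xn0] := eqVneq (rnorm x) 0.
  exists 0; rewrite (rnorm0_eq0 x0') subrr !rnorm0; split=> // i.
  by rewrite F0 rnorm0 mulr0.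
have xp : 0 < rnorm x by rewrite lt_neqAle eq_sym xn0 rnorm_ge0.
(* Brings [x] to length [r / 2], inside the ball; dividing the bound [2 * n] by [k] yields the
   constant [4 * n / r]. *)
pose k := r / (2 * rnorm x).
have k0 : 0 < k by rewrite divr_gt0// mulr_gt0.
have ke : 0 < k * e / 2 by rewrite divr_gt0// mulr_gt0.
have kx : rnorm (k%:C *: x) < r.
  rewrite rnormZr gtr0_norm// /k invfM -!mulrA mulVf// mulr1; lra.
have /closure_rnorm/(_ _ ke)[s1 s1P d1] : 
    closure [set x | forall i, rnorm (F i x) <= n%:R] (x0 + k%:C *: x).
  by apply: ball; rewrite addrC addKr.
have /closure_rnorm/(_ _ ke)[s2 s2P d2] : 
    closure [set x | forall i, rnorm (F i x) <= n%:R] x0.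
  by apply: ball; rewrite subrr rnorm0.
exists ((k^-1)%:C *: (s1 - s2)); split.
  have -> : x - (k^-1)%:C *: (s1 - s2) =
      (k^-1)%:C *: ((x0 + k%:C *: x - s1) - (x0 - s2)).
    have -> : x0 + k%:C *: x - s1 - (x0 - s2) = k%:C *: x - (s1 - s2).
      by rewrite opprB addrC -[_ + _ - s1]addrA addrA subrK opprB addrCA.
    by rewrite [RHS]scalerBr scalerA -rmorphM/= mulVf ?gt_eqF// scale1r.
  rewrite rnormZr gtr0_norm ?invr_gt0// mulrC ltr_pdivrMr//.
  have := rnormB (x0 + k%:C *: x - s1) (x0 - s2); lra.
move=> i; rewrite FZ rnormZr gtr0_norm ?invr_gt0// FB.
rewrite mulrC ler_pdivrMr//.
have -> : 4 * n%:R / r * rnorm x * k = 2 * n%:R.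
  by rewrite /k; field; rewrite xn0 gt_eqF.
have := rnormB (F i s1) (F i s2); have := s1P i; have := s2P i; lra.
Qed.

(** Successive approximation: [x] is a sum of corrections whose images decrease geometrically,
    whence the factor 2. Closedness of the graph identifies the sum of the images with [F i x]. *)
Theorem closed_graph_bounded :
  exists2 C : R, 0 <= C & forall i x, rnorm (F i x) <= C * rnorm x.
Proof.
have [C C0 approx] := closed_graph_approx.
exists (2 * C) => [|i x]; first by rewrite mulr_ge0.
have [x0'|xn0] := eqVneq (rnorm x) 0.
  by rewrite (rnorm0_eq0 x0') F0 !rnorm0 mulr0.
have xp : 0 < rnorm x by rewrite lt_neqAle eq_sym xn0 rnorm_ge0.
have e0 n : 0 < rnorm x * 2^-1 ^+ n by rewrite mulr_gt0// exprn_gt0.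
have [y yP] := choice (fun nz : nat * V => approx nz.2 _ (e0 nz.1.+1)).
(* [z n] is the remainder after [n] corrections; step [n] asks for precision
   [rnorm x * 2^-1 ^+ n.+1], so the remainders halve. *)
pose z := fix z n := if n is n'.+1 then z n' - y (n', z n') else x.
have zb n : rnorm (z n) <= rnorm x * 2^-1 ^+ n.
  case: n => [|n]; first by rewrite expr0 mulr1.
  by have [/ltW] := yP (n, z n).
have Fz n : rnorm (F i (x - z n.+1) - F i (x - z n)) <= C * rnorm x * 2^-1 ^+ n.
  rewrite -FB /= (opprB (z n)) addrCA addrK.
  have [_ /(_ i) h] := yP (n, z n); apply: le_trans h _.
  by rewrite -mulrA ler_wpM2l// zb.
have [g gP] := geometric_cvg Fz.
suff -> : F i x = g.
  have := gP 0%N; rewrite /= subrr F0 sub0r rnormN expr0 mulr1; lra.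
apply/esym/eqP; rewrite -subr_eq0; apply/eqP.
apply: (F_closed (i := i)) => e ep.
have [n nP] := exists_half_exp (Num.max (rnorm x) (C * rnorm x * 2)) ep.
(* The remainders tend to 0, while [F i (- z n)] tends to [g - F i x]. *)
exists (- z n); split.
  rewrite rnormN (le_lt_trans (zb n))// (le_lt_trans _ nP)//.
  by rewrite ler_wpM2r ?exprn_ge0// le_max lexx.
have -> : F i (- z n) - (g - F i x) = F i (x - z n) - g.
  have -> : F i (- z n) = - F i (z n) by rewrite -sub0r FB F0 sub0r.
  by rewrite FB opprB addrA [- _ + _]addrC.
rewrite (le_lt_trans (gP n))// (le_lt_trans _ nP)//.
by rewrite ler_wpM2r ?exprn_ge0// le_max lexx orbT.
Qed.

End ClosedGraph.

(** * Boundedness of representations *)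

Section CStarBasics.
Context {R : realType} {A : cstarType R}.
Implicit Types a b c s : A.

Lemma amulNr a b : a ** - b = - (a ** b).
Proof. by rewrite -scaleN1r amulZr scaleN1r. Qed.

Lemma amulNl a b : - a ** b = - (a ** b).
Proof. by rewrite -scaleN1r amulZl scaleN1r. Qed.

Lemma amulBr a b c : a ** (b - c) = a ** b - a ** c.
Proof. by rewrite amulDr amulNr. Qed.

Lemma amulBl a b c : (a - b) ** c = a ** c - b ** c.
Proof. by rewrite amulDl amulNl. Qed.

Lemma starN a : star (- a) = - star a.
Proof. by rewrite -scaleN1r starZ rmorphN rmorph1 scaleN1r. Qed.

Lemma starB a b : star (a - b) = star a - star b.
Proof. by rewrite starD starN. Qed.

Lemma star0 : star (0 : A) = 0.
Proof. by rewrite -{1}(subrr (0 : A)) starB subrr. Qed.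

Lemma rnorm_amul a b : rnorm (a ** b) <= rnorm a * rnorm b.
Proof. by rewrite -lecR rmorphM/= -!rnormE normA_mul. Qed.

Lemma rnorm_cstar a : rnorm (star a ** a) = rnorm a ^+ 2.
Proof. by apply: complexI; rewrite rmorphXn/= -!rnormE cstar_id. Qed.

Lemma rnorm_star a : rnorm (star a) = rnorm a.
Proof.
suff le b : rnorm b <= rnorm (star b).
  by apply/eqP; rewrite eq_le le -{2}(starK a) le.
have := rnorm_ge0 b; rewrite le_eqVlt => /orP[/eqP <-|b0].
  exact: rnorm_ge0.
by rewrite -(ler_pM2r b0) -expr2 -rnorm_cstar rnorm_amul.
Qed.

Lemma positive_star a : positive a -> star a = a.
Proof. by move=> [b ->]; rewrite starM starK. Qed.

(* [1 - a] has the square root [1 - s], the fixed point of s |-> (a + s^2) / 2 *)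
Lemma sqrt_one_minus a : star a = a -> rnorm a <= 3 / 4 ->
  exists2 s, star s = s & s + s - s ** s = a.
Proof.
move=> sa a34; pose h : R[i] := (2^-1)%:C.
have hC : Num.conj h = h by exact: conjc_real.
pose g s := h *: (a + s ** s).
have rh (x : A) : rnorm (h *: x) = 2^-1 * rnorm x.
  by rewrite rnormZr gtr0_norm.
have g_lip s s' : rnorm s <= 2^-1 -> rnorm s' <= 2^-1 ->
    rnorm (g s - g s') <= 2^-1 * rnorm (s - s').
  move=> s2 s'2; rewrite -scalerBr rh ler_wpM2l// opprD addrACA subrr add0r.
  have -> : s ** s - s' ** s' = s ** (s - s') + (s - s') ** s'.
    by rewrite amulBr amulBl addrA subrK.
  have := rnormD (s ** (s - s')) ((s - s') ** s').
  have := rnorm_amul s (s - s'); have := rnorm_amul (s - s') s'.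
  have := rnorm_ge0 (s - s'); nra.
pose u := fix u n := if n is n'.+1 then g (u n') else 0.
(* The ball of radius 1/2 is stable because 3/4 + 1/4 = 1, and on it [g] halves distances. *)
have ub n : rnorm (u n) <= 2^-1.
  elim: n => [|n ih] /=; first by rewrite rnorm0; lra.
  rewrite rh; have := rnormD a (u n ** u n).
  by have := rnorm_amul (u n) (u n); have := rnorm_ge0 (u n); nra.
have us n : star (u n) = u n.
  elim: n => [|n ih] /=; first exact: star0.
  by rewrite starZ starD starM sa ih hC.
have [|l lP] := @geometric_cvg _ A u (rnorm (u 1%N)).
  elim=> [|n ih]; first by rewrite subr0 expr0 mulr1.
  rewrite exprS mulrCA; apply: le_trans (g_lip (u n.+1) (u n) (ub _) (ub _)) _.
  by rewrite ler_wpM2l.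
have approx (e : R) : 0 < e -> exists2 n, rnorm (u n - l) < e & rnorm (u n.+1 - l) < e.
  move=> e0; have [n nP] := exists_half_exp (rnorm (u 1%N) * 2) e0.
  exists n; first exact: le_lt_trans (lP n) nP.
  apply: le_lt_trans (lP _) (le_lt_trans _ nP).
  rewrite exprS ler_wpM2l ?mulr_ge0 ?rnorm_ge0//.
  by rewrite ler_piMl ?exprn_ge0//; lra.
have l2 : rnorm l <= 2^-1.
  apply/ler_addgt0Pr => e e0; have [n] := approx _ e0.
  by have := rnormB (u n) (u n - l); rewrite subKr; have := ub n; lra.
exists l.
  apply/eqP; rewrite -subr_eq0; apply/eqP.
  apply: (@rnorm_small0 _ _ _ 2) => e /approx[n d _].
  have := rdistD (u n) (star l) l; rewrite -{1}(us n) -starB rnorm_star.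
  rewrite (rdistC l); lra.
have lg : l = g l.
  apply/eqP; rewrite -subr_eq0; apply/eqP.
  apply: (@rnorm_small0 _ _ _ 2) => e e0; have [n d d'] := approx _ e0.
  have := rdistD (u n.+1) l (g l); have /= := g_lip _ _ (ub n) l2.
  rewrite (rdistC l (g _)) (rdistC l); lra.
have : l + l = a + l ** l.
  rewrite {1 2}lg -scalerDl -rmorphD/= -[RHS]scale1r; congr (_ *: _).
  by congr (_%:C); lra.
by move=> ->; rewrite addrK.
Qed.

End CStarBasics.

Section HilbertSpaceBasics.
Context {R : realType} {H : hilbertSpaceType R}.
Implicit Types x y z : H.

Lemma hdotDl x y z : hdot (x + y) z = hdot x z + hdot y z.
Proof. by rewrite hdotC hdotDr rmorphD/= -!hdotC. Qed.

Lemma hdotNr x y : hdot x (- y) = - hdot x y.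
Proof. by rewrite -scaleN1r hdotZr mulN1r. Qed.

Lemma hdotNl x y : hdot (- x) y = - hdot x y.
Proof. by rewrite hdotC hdotNr rmorphN/= -hdotC. Qed.

Lemma rnorm_hdot x : (rnorm x ^+ 2)%:C = hdot x x.
Proof. by rewrite rmorphXn/= -rnormE norm_hdot. Qed.

Context {A : cstarType R} (pi : A -> {linear H -> H}).
Hypothesis pi_rep : representation pi.

(** With [s] self-adjoint and 1 - a* a = (1 - s)^2, the difference of the squared norms of [h] and
    [pi a h] is the squared norm of [h - pi s h], hence nonnegative. The unit 1 is only formal, so
    [A] may be nonunital. *)
Lemma representation_contract (a : A) (h : H) : rnorm a <= 3 / 4 ->
  rnorm (pi a h) <= rnorm h.
Proof.
have [_ pi_lin piM pi_star] := pi_rep => a34.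
have piD (b c : A) : pi (b + c) h = pi b h + pi c h.
  by have := pi_lin 1 b c h; rewrite !scale1r.
have piN (b : A) : pi (- b) h = - pi b h.
  have pi0 : pi 0 h = 0 by apply: (@addrI _ (pi 0 h)); rewrite -piD !addr0.
  by apply: (@addrI _ (pi b h)); rewrite -piD !subrr.
have [||s ss s_eq] := @sqrt_one_minus _ _ (star a ** a).
- by rewrite starM starK.
- by rewrite rnorm_cstar; have := rnorm_ge0 a; nra.
suff : rnorm (pi a h) ^+ 2 + rnorm (h - pi s h) ^+ 2 = rnorm h ^+ 2.
  by have := rnorm_ge0 (pi a h); have := rnorm_ge0 h;
     have := sqr_ge0 (rnorm (h - pi s h)); nra.
apply: complexI; rewrite rmorphD/= !rnorm_hdot.
rewrite pi_star -piM -s_eq !piD piN piM.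
rewrite !(hdotDl, hdotDr, hdotNl, hdotNr).
by rewrite !pi_star ss; ring.
Qed.

Lemma representation_bounded (a : A) (h : H) :
  rnorm (pi a h) <= 2 * rnorm a * rnorm h.
Proof.
have [_ pi_lin _ _] := pi_rep.
have piZ (k : R[i]) (b : A) : pi (k *: b) h = k *: pi b h.
  have pi0 : pi 0 h = 0.
    by have := pi_lin (-1) 0 0 h; rewrite !scaleN1r oppr0 addr0 addNr.
  by have := pi_lin k b 0 h; rewrite pi0 !addr0.
have [a0|an0] := eqVneq (rnorm a) 0.
  have {1}-> : a = (0 : R[i]) *: a by rewrite (rnorm0_eq0 a0) scaler0.
  by rewrite piZ scale0r rnorm0 a0 mulr0 mul0r.
have ap : 0 < rnorm a by rewrite lt_neqAle eq_sym an0 rnorm_ge0.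
(* Scales [a] to norm 1/2, within reach of the contraction lemma; this is the origin of the factor
   2. *)
pose k := (2 * rnorm a)^-1.
have kp : 0 < k by rewrite invr_gt0 mulr_gt0.
have ka : k * rnorm a = 2^-1 by rewrite /k; field.
have : rnorm (pi (k%:C *: a) h) <= rnorm h.
  by apply: representation_contract; rewrite rnormZr gtr0_norm// ka; lra.
by rewrite piZ rnormZr gtr0_norm// -ler_pdivlMl// /k invrK.
Qed.

End HilbertSpaceBasics.

(** * Boundedness of the spatial tensor product *)

Section Bilinear.
Context {K : comNzRingType} {U V W : lmodType K} (f : U -> V -> W).
Hypothesis f_bil : bilinear_for *:%R *:%R f.

Lemma bilDl u u' v : f (u + u') v = f u v + f u' v.
Proof. by have := f_bil.1 v 1 u u'; rewrite /= !scale1r. Qed.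

Lemma bilDr u v v' : f u (v + v') = f u v + f u v'.
Proof. by have := f_bil.2 u 1 v v'; rewrite /= !scale1r. Qed.

Lemma bil0l v : f 0 v = 0.
Proof. by apply: (@addrI _ (f 0 v)); rewrite -bilDl !addr0. Qed.

Lemma bil0r u : f u 0 = 0.
Proof. by apply: (@addrI _ (f u 0)); rewrite -bilDr !addr0. Qed.

Lemma bilZl k u v : f (k *: u) v = k *: f u v.
Proof. by have := f_bil.1 v k u 0; rewrite /= bil0l !addr0. Qed.

Lemma bilZr k u v : f u (k *: v) = k *: f u v.
Proof. by have := f_bil.2 u k v 0; rewrite /= bil0r !addr0. Qed.

Lemma bilBl u u' v : f (u - u') v = f u v - f u' v.
Proof. by rewrite -scaleN1r bilDl bilZl scaleN1r. Qed.

Lemma bilBr u v v' : f u (v - v') = f u v - f u v'.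
Proof. by rewrite -scaleN1r bilDr bilZr scaleN1r. Qed.

Lemma bil_suml (I : Type) (r : seq I) (u : I -> U) v :
  f (\sum_(i <- r) u i) v = \sum_(i <- r) f (u i) v.
Proof.
by elim: r => [|i r ih]; rewrite ?big_nil ?bil0l// !big_cons bilDl ih.
Qed.

Lemma bil_sumr (I : Type) (r : seq I) u (v : I -> V) :
  f u (\sum_(i <- r) v i) = \sum_(i <- r) f u (v i).
Proof.
by elim: r => [|i r ih]; rewrite ?big_nil ?bil0r// !big_cons bilDr ih.
Qed.

End Bilinear.

Section RepresentationLinear.
Context {R : realType} {A : cstarType R} {H : hilbertSpaceType R}.
Context (pi : A -> {linear H -> H}).
Hypothesis pi_rep : representation pi.

Lemma representationB a b h : pi (a - b) h = pi a h - pi b h.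
Proof.
have [_ pi_lin _ _] := pi_rep.
by rewrite -[a - b]addrC -scaleN1r pi_lin scaleN1r addrC.
Qed.

Lemma representation0 h : pi 0 h = 0.
Proof. by rewrite -(subrr (0 : A)) representationB subrr. Qed.

End RepresentationLinear.

Section TensorBounded.
Context {R : realType} {A B AB : cstarType R} (t : A -> B -> AB).

Lemma hilbert_tensor_norm (H K L : hilbertSpaceType R) (f : H -> K -> L) h k :
  hilbert_space_tensor f -> rnorm (f h k) = rnorm h * rnorm k.
Proof.
move=> [_ fdot _].
apply/eqP; rewrite -(@eqrXn2 _ 2)// ?mulr_ge0 ?rnorm_ge0//; apply/eqP.
by apply: complexI; rewrite exprMn rnorm_hdot fdot -!rnorm_hdot -rmorphM.
Qed.

Section Faithful.
Context (H K L : hilbertSpaceType R) (f : H -> K -> L).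
Context (pi : A -> {linear H -> H}) (sigma : B -> {linear K -> K}).
Context (rho : AB -> {linear L -> L}).
Hypothesis f_tensor : hilbert_space_tensor f.
Hypothesis rho_rep : faithful_representation rho.
Hypothesis rhoE : forall a b h k, rho (t a b) (f h k) = f (pi a h) (sigma b k).

(** [rho c] is bounded and the vectors [f h k] span a dense subspace, so [rho c] vanishes everywhere
    and faithfulness applies. *)
Lemma faithful_separates c : (forall h k, rho c (f h k) = 0) -> c = 0.
Proof.
move=> c0; have [rep inj] := rho_rep; have [_ _ f_dense] := f_tensor.
apply: inj => v; rewrite representation0//.
apply: (@rnorm_small0 _ _ _ (2 * rnorm c)) => e e0.
have [w [n [h [k [_ wE]]]] vw] := dense_rnorm f_dense v e0.
have w0 : rho c w = 0.
  by rewrite wE linear_sum big1// => i _; exact: c0.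
rewrite -[rho c v]subr0 -w0 -linearB/=.
apply: le_trans (representation_bounded rep _ _) _.
by rewrite ler_wpM2l ?mulr_ge0 ?rnorm_ge0// ltW.
Qed.

(** Common form of the closedness of both partial maps of [t]: on [f h k], the operator of [t a b]
    is small by the premise and that of [t a b - g] by boundedness of [rho]. The factors [a] and [b]
    may depend on [h], [k] and [e]. *)
Lemma faithful_closed g (C : R) : (forall h k (e : R), 0 < e -> exists a b,
    rnorm (pi a h) * rnorm (sigma b k) <= C * rnorm h * rnorm k * e /\
    rnorm (t a b - g) < e) -> g = 0.
Proof.
move=> approx; have [rep _] := rho_rep.
apply: faithful_separates => h k.
apply: (@rnorm_small0 _ _ _ ((C + 2) * rnorm h * rnorm k)) => e e0.
have [a [b [ab d]]] := approx h k e e0.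
have -> : rho g (f h k) =
    rho (t a b) (f h k) - rho (t a b - g) (f h k).
  by rewrite representationB// subKr.
have := rnormB (rho (t a b) (f h k)) (rho (t a b - g) (f h k)).
rewrite {2}rhoE (hilbert_tensor_norm _ _ f_tensor).
have := representation_bounded rep (t a b - g) (f h k).
rewrite (hilbert_tensor_norm _ _ f_tensor).
have : 2 * rnorm (t a b - g) * (rnorm h * rnorm k) <=
       2 * e * (rnorm h * rnorm k).
  by rewrite ler_wpM2r ?mulr_ge0 ?rnorm_ge0// ler_wpM2l// ltW.
lra.
Qed.

End Faithful.

(* Only the boundedness of representations is elementary here, not the isometry
   of faithful ones: faithfulness of [rho] makes the graphs of [t a] and
   [t^~ b] closed. *)
Theorem minimal_tensor_bounded : minimal_tensor t ->
  exists2 C : R, 0 <= C & forall a b, rnorm (t a b) <= C * rnorm a * rnorm b.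
Proof.
case=> t_bil _ _ _ [H [K [L [f [pi [sigma [rho [f_tensor pi_f sigma_f rho_f rhoE]]]]]]]].
have [pi_rep _] := pi_f; have [sigma_rep _] := sigma_f.
(* A single map, with index type [unit]: the constant still depends on [a]. *)
have right_bounded a : exists2 C : R, 0 <= C &
    forall b, rnorm (t a b) <= C * rnorm b.
  have [|||C C0 CP] := @closed_graph_bounded _ _ _ unit (fun _ => t a).
  - by move=> _ k x y; rewrite (bilDr t_bil) (bilZr t_bil).
  - move=> _ g gP.
    apply: (@faithful_closed _ _ _ _ _ _ _ f_tensor rho_f rhoE g (4 * rnorm a)).
    move=> h k e /gP[b [be d]]; exists a, b; split=> //.
    have := ler_pM (rnorm_ge0 _) (rnorm_ge0 _)
      (representation_bounded pi_rep a h) (representation_bounded sigma_rep b k).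
    move=> /le_trans; apply.
    rewrite [leLHS](_ : _ = (4 * rnorm a * rnorm h * rnorm k) * rnorm b); last by ring.
    by rewrite ler_wpM2l ?mulr_ge0 ?rnorm_ge0// ltW.
  - by move=> b; exists (rnorm (t a b)).
  by exists C => // b; exact: CP tt b.
(* The family is indexed by the unit ball of [B]; the previous bound is its pointwise boundedness,
   and the resulting constant is uniform. *)
have [|||C C0 CP] := @closed_graph_bounded _ _ _ {b : B | rnorm b <= 1}
    (fun b a => t a (sval b)).
- by move=> b k x y; rewrite (bilDl t_bil) (bilZl t_bil).
- move=> [b b1] g gP /=.
  apply: (@faithful_closed _ _ _ _ _ _ _ f_tensor rho_f rhoE g 4).
  move=> h k e /gP[a [ae d]]; exists a, b; split=> //.
  have := ler_pM (rnorm_ge0 _) (rnorm_ge0 _)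
    (representation_bounded pi_rep a h) (representation_bounded sigma_rep b k).
  move=> /le_trans; apply.
  rewrite [leLHS](_ : _ = (4 * rnorm h * rnorm k) * (rnorm a * rnorm b)); last by ring.
  rewrite ler_wpM2l ?mulr_ge0 ?rnorm_ge0//.
  by have := rnorm_ge0 a; nra.
- move=> a; have [C C0 CP] := right_bounded a.
  by exists C => -[b b1] /=; rewrite (le_trans (CP b))// ler_piMr.
exists C => // a b; have [b0|bn0] := eqVneq (rnorm b) 0.
  by rewrite (rnorm0_eq0 b0) (bil0r t_bil) !rnorm0 mulr0.
have bp : 0 < rnorm b by rewrite lt_neqAle eq_sym bn0 rnorm_ge0.
have b1 : rnorm ((rnorm b)^-1%:C *: b) <= 1.
  by rewrite rnormZr gtr0_norm ?invr_gt0// mulVf.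
have := CP (exist (fun b : B => is_true (rnorm b <= 1)) _ b1) a.
rewrite /= (bilZr t_bil) rnormZr gtr0_norm ?invr_gt0//.
by rewrite ler_pdivrMl// mulrC.
Qed.

End TensorBounded.

(** * Tensor products of adjointable operators *)

Lemma rnorm_double (R : realType) (V : normedModType R[i]) (u : V) :
  rnorm (u + u) = 2 * rnorm u.
Proof.
have -> : u + u = (1 + 1)%:C *: u by rewrite rmorphD/= scalerDl scale1r.
by rewrite rnormZr gtr0_norm//; lra.
Qed.

Section HilbertModuleBasics.
Context {R : realType} {A : cstarType R} {X : hilbertModType A}.
Implicit Types (x y z : X) (a : A).

Local Notation "⟪ x , y ⟫" := (hinner x y : A)
  (at level 0, x at level 69, y at level 69, format "⟪ x ,  y ⟫").

Lemma hinnerDl x y z : ⟪x + y, z⟫ = ⟪x, z⟫ + ⟪y, z⟫.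
Proof. by rewrite hinnerC hinnerDr starD -!hinnerC. Qed.

Lemma hinnerZl (k : R[i]) x y : ⟪k *: x, y⟫ = Num.conj k *: ⟪x, y⟫.
Proof. by rewrite hinnerC hinnerZr starZ -hinnerC. Qed.

Lemma hinnerNr x y : ⟪x, - y⟫ = - ⟪x, y⟫.
Proof. by rewrite -scaleN1r hinnerZr scaleN1r. Qed.

Lemma hinnerNl x y : ⟪- x, y⟫ = - ⟪x, y⟫.
Proof. by rewrite hinnerC hinnerNr starN -hinnerC. Qed.

Lemma hinner0r x : ⟪x, 0⟫ = 0.
Proof. by rewrite -(scale0r 0) hinnerZr scale0r. Qed.

Lemma hinner0l x : ⟪0, x⟫ = 0.
Proof. by rewrite hinnerC hinner0r star0. Qed.

Lemma hinner_sumr (I : Type) (r : seq I) (P : pred I) x (y : I -> X) :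
  ⟪x, \sum_(i <- r | P i) y i⟫ = \sum_(i <- r | P i) ⟪x, y i⟫.
Proof. by elim/big_rec2 : _ => [|i u v _ <-]; rewrite ?hinner0r ?hinnerDr. Qed.

Lemma hinner_suml (I : Type) (r : seq I) (P : pred I) (x : I -> X) y :
  ⟪\sum_(i <- r | P i) x i, y⟫ = \sum_(i <- r | P i) ⟪x i, y⟫.
Proof. by elim/big_rec2 : _ => [|i u v _ <-]; rewrite ?hinner0l ?hinnerDl. Qed.

Lemma rnorm_hinner x : rnorm (⟪x, x⟫) = rnorm x ^+ 2.
Proof.
by apply: complexI; rewrite rmorphXn/= -!rnormE; exact/esym/norm_hinner.
Qed.

Lemma rnorm_ract x a : rnorm (ract x a) <= rnorm x * rnorm a.
Proof.
rewrite -ler_sqr ?nnegrE ?mulr_ge0 ?rnorm_ge0// exprMn -!rnorm_hinner.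
rewrite hinner_ract hinnerC hinner_ract starM -hinnerC.
rewrite (le_trans (rnorm_amul _ _))// (le_trans (ler_wpM2r _ (rnorm_amul _ _)))//.
  exact: rnorm_ge0.
by rewrite rnorm_star expr2 mulrAC [leLHS]mulrC mulrA.
Qed.

Lemma ractNl x a : ract (- x) a = - ract x a.
Proof. by rewrite -scaleN1r ractZl scaleN1r. Qed.

Lemma ractNr x a : ract x (- a) = - ract x a.
Proof. by rewrite -scaleN1r ractZr scaleN1r. Qed.

Lemma ractBl x y a : ract (x - y) a = ract x a - ract y a.
Proof. by rewrite ractDl ractNl. Qed.

Lemma ractBr x a b : ract x (a - b) = ract x a - ract x b.
Proof. by rewrite ractDr ractNr. Qed.

(** Polarization: the squares of [x + y] and [x - y] differ by twice the symmetric part, and the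
    norm of each square is at most the right-hand side. *)
Lemma rnorm_hinner_sym x y :
  rnorm (⟪x, y⟫ + ⟪y, x⟫) <= (rnorm x + rnorm y) ^+ 2.
Proof.
pose p := ⟪x, x⟫ + ⟪y, y⟫; pose q := ⟪x, y⟫ + ⟪y, x⟫.
have pq : ⟪x + y, x + y⟫ = p + q.
  by rewrite hinnerDl !hinnerDr [⟪y, x⟫ + _]addrC addrACA.
have pNq : ⟪x - y, x - y⟫ = p - q.
  rewrite hinnerDl !hinnerDr !hinnerNr !hinnerNl opprK.
  by rewrite [- ⟪y, x⟫ + _]addrC addrACA -opprD.
have e : ⟪x + y, x + y⟫ - ⟪x - y, x - y⟫ = q + q.
  by rewrite pq pNq opprB addrC addrA subrK.
have := rnormB (⟪x + y, x + y⟫) (⟪x - y, x - y⟫).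
rewrite e rnorm_double !rnorm_hinner.
have := rnormD x y; have := rnormB x y; have := rnorm_ge0 (x + y).
have := rnorm_ge0 (x - y); have := rnorm_ge0 x; have := rnorm_ge0 y; nra.
Qed.

Lemma rnorm_hinner_add x y : rnorm (⟪x, y⟫) <= (rnorm x + rnorm y) ^+ 2.
Proof.
(* Replacing [y] by i y bounds the antisymmetric part in the same way; the two parts add up to twice
   the inner product. *)
pose k : R[i] := 0 +i* 1.
have kC : Num.conj k = - k by apply/eqP; rewrite eq_complex /= oppr0 !eqxx.
have k1 (V : normedModType R[i]) (v : V) : rnorm (k *: v) = rnorm v.
  by rewrite rnormZ normc_def/= expr0n expr1n add0r sqrtr1 mul1r.
have := rnorm_hinner_sym x (k *: y).
rewrite hinnerZl hinnerZr kC scaleNr -scalerBr !k1.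
have := rnorm_hinner_sym x y.
have := rnormD (⟪x, y⟫ + ⟪y, x⟫) (⟪x, y⟫ - ⟪y, x⟫).
rewrite addrACA subrr addr0 rnorm_double; lra.
Qed.

(* The constant 4 comes from polarization. *)
Lemma rnorm_hinner_le x y : rnorm (⟪x, y⟫) <= 4 * rnorm x * rnorm y.
Proof.
have [x0|xn0] := eqVneq (rnorm x) 0.
  by rewrite (rnorm0_eq0 x0) hinner0l !rnorm0 mulr0 mul0r.
have [y0|yn0] := eqVneq (rnorm y) 0.
  by rewrite (rnorm0_eq0 y0) hinner0r !rnorm0 mulr0.
have xp : 0 < rnorm x by rewrite lt_neqAle eq_sym xn0 rnorm_ge0.
have yp : 0 < rnorm y by rewrite lt_neqAle eq_sym yn0 rnorm_ge0.
have := rnorm_hinner_add ((rnorm x)^-1%:C *: x) ((rnorm y)^-1%:C *: y).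
have rC (r : R) : Num.conj r%:C = r%:C by exact: conjc_real.
rewrite hinnerZl hinnerZr rC !rnormZr !gtr0_norm ?invr_gt0// !mulVf//.
rewrite !ler_pdivrMl//; lra.
Qed.

(** Neither linearity nor boundedness is part of the notion: additivity follows from the existence
    of an adjoint, and bounds are supplied separately. *)
Definition adjoint_pair (T T' : X -> X) :=
  forall x y, ⟪T x, y⟫ = ⟪x, T' y⟫.

Lemma adjoint_pairC T T' : adjoint_pair T T' -> adjoint_pair T' T.
Proof. by move=> TT' x y; rewrite hinnerC -TT' -hinnerC. Qed.

Lemma adjoint_pairB T T' S S' : adjoint_pair T T' -> adjoint_pair S S' ->
  adjoint_pair (fun x => T x - S x) (fun x => T' x - S' x).
Proof.
by move=> TT' SS' x y; rewrite hinnerDl hinnerDr hinnerNl hinnerNr TT' SS'.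
Qed.

(** The square of [rnorm (T' x)] is the norm of the inner product of [T (T' x)] and [x], to which
    Cauchy-Schwarz with its factor 4 applies. *)
Lemma adjoint_bound T T' (c : R) : adjoint_pair T T' ->
  (forall x, rnorm (T x) <= c * rnorm x) ->
  forall x, rnorm (T' x) <= 4 * c * rnorm x.
Proof.
move=> TT' Tc x; have [T0|Tn0] := eqVneq (rnorm (T' x)) 0.
  rewrite T0 -mulrA mulr_ge0//; apply: le_trans (Tc x); exact: rnorm_ge0.
have Tp : 0 < rnorm (T' x) by rewrite lt_neqAle eq_sym Tn0 rnorm_ge0.
rewrite -(ler_pM2r Tp) -expr2 -rnorm_hinner -TT'.
apply: le_trans (rnorm_hinner_le _ _) _.
have := Tc (T' x); have := rnorm_ge0 x; nra.
Qed.

Lemma adjoint_gram T T' : adjoint_pair T T' -> adjoint_pair (T' \o T) (T' \o T).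
Proof. by move=> TT' x y /=; rewrite -TT' (adjoint_pairC TT'). Qed.

Lemma adjoint_iter S k : adjoint_pair S S -> adjoint_pair (iter k S) (iter k S).
Proof.
move=> SS; elim: k => [//|k ih] x y.
by rewrite iterS SS ih -iterSr.
Qed.

End HilbertModuleBasics.

(** If [r 0] exceeded [q], repeated squaring would make [r k] at least [r 0 ^+ (2 ^ k)], which
    outgrows [K * q ^+ (2 ^ k)] whatever [K] is. The constant is lost as in the spectral radius
    formula. *)
Lemma power_growth (R : realType) (r : nat -> R) (K q : R) : 0 <= q ->
  (forall k, 0 <= r k) -> (forall k, r k ^+ 2 <= r k.+1) ->
  (forall k, r k <= K * q ^+ (2 ^ k)) -> r 0%N <= q.
Proof.
move=> q0 r_ge0 r_sq rK; rewrite leNgt; apply/negP => qr.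
have r0p : 0 < r 0%N by exact: le_lt_trans qr.
have rb k : r 0%N ^+ (2 ^ k) <= r k.
  elim: k => [//|k ih]; rewrite expnS mulnC exprM.
  by apply: le_trans (r_sq k); rewrite ler_sqr ?nnegrE ?exprn_ge0.
have /cvgrPdist_lt/(_ 1 ltr01) :
    K * (q / r 0%N) ^+ n @[n --> \oo] --> (0 : R).
  rewrite -[X in _ --> X](mulr0 K); apply: cvgMr; apply: cvg_expr.
  have q1 : 0 <= q / r 0%N by rewrite divr_ge0.
  by rewrite (ger0_norm q1) ltr_pdivrMr// mul1r.
move=> [N _ /(_ (2 ^ N)%N (ltnW (ltn_expl N (isT : (1 < 2)%N))))] /=.
rewrite sub0r normrN ltNge => /negP; apply.
apply: le_trans (ler_norm _).
rewrite expr_div_n mulrA ler_pdivlMr ?exprn_gt0// mul1r.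
exact: le_trans (rb N) (rK N).
Qed.

Section TensorOperator.
Context {R : realType} {A B AB : cstarType R}.
Context {X1 : hilbertModType A} {X2 : hilbertModType B}.
Context {X : hilbertModType AB} {t : A -> B -> AB} {f : X1 -> X2 -> X}.
Hypothesis t_min : minimal_tensor t.
Hypothesis f_tensor : external_tensor t f.

Lemma tensor_bounded : exists2 D : R, 0 <= D &
  forall x y, rnorm (f x y) <= D * rnorm x * rnorm y.
Proof.
have [C C0 tC] := minimal_tensor_bounded t_min.
have [_ _ f_inner _] := f_tensor.
(* [C + 1] replaces the square root of [C], as [C <= (C + 1) ^+ 2]. *)
exists (C + 1) => [|x y]; first lra.
rewrite -ler_sqr ?nnegrE ?mulr_ge0 ?rnorm_ge0//; last lra.
rewrite -rnorm_hinner f_inner (le_trans (tC _ _))// !rnorm_hinner.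
by rewrite !exprMn !ler_wpM2r ?sqr_ge0//; nra.
Qed.

(* With [S1 = T1' \o T1], [S2 = T2' \o T2] and
   [z k = \sum_i f (S1^k (x i)) (S2^k (y i))], Cauchy-Schwarz gives
   [|z (2^k)|^2 <= 4 |z 0| |z (2^(k+1))|], while [|z k|] grows at most
   geometrically: this bounds [z 1] without positivity of operator matrices. *)
Lemma tensor_op_le (T1 T1' : X1 -> X1) (T2 T2' : X2 -> X2) (c1 c2 : R)
    (n : nat) (x : 'I_n -> X1) (y : 'I_n -> X2) :
  adjoint_pair T1 T1' -> adjoint_pair T2 T2' -> 0 <= c1 -> 0 <= c2 ->
  (forall x, rnorm (T1 x) <= c1 * rnorm x) ->
  (forall y, rnorm (T2 y) <= c2 * rnorm y) ->
  rnorm (\sum_(i < n) f (T1 (x i)) (T2 (y i))) <=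
    16 * c1 * c2 * rnorm (\sum_(i < n) f (x i) (y i)).
Proof.
move=> adj1 adj2 c1_ge0 c2_ge0 T1c T2c.
have [_ _ f_inner _] := f_tensor; have [D D0 fD] := tensor_bounded.
pose S1 := T1' \o T1; pose S2 := T2' \o T2.
pose z k := \sum_(i < n) f (iter k S1 (x i)) (iter k S2 (y i)).
have z_inner j k : hinner (z j) (z k) = hinner (z 0%N) (z (j + k)%N) :> AB.
  rewrite !hinner_suml; apply: eq_bigr => i _.
  rewrite !hinner_sumr; apply: eq_bigr => i' _.
  rewrite !f_inner !(adjoint_iter _ (adjoint_gram adj1)).
  by rewrite !(adjoint_iter _ (adjoint_gram adj2)) -!iterD.
have z_sq k : rnorm (z k) ^+ 2 <= 4 * rnorm (z 0%N) * rnorm (z (k + k)%N).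
  by rewrite -rnorm_hinner z_inner rnorm_hinner_le.
set G := \sum_(i < n) f (T1 (x i)) _.
have G_sq : rnorm G ^+ 2 <= 4 * rnorm (z 0%N) * rnorm (z 1%N).
  rewrite -rnorm_hinner [hinner G G](_ : _ = hinner (z 0%N) (z 1%N)).
    exact: rnorm_hinner_le.
  rewrite !hinner_suml; apply: eq_bigr => i _.
  rewrite !hinner_sumr; apply: eq_bigr => i' _.
  by rewrite !f_inner adj1 adj2.
have S1c k u : rnorm (iter k S1 u) <= (4 * c1 ^+ 2) ^+ k * rnorm u.
  elim: k => [|k ih]; first by rewrite expr0 mul1r.
  rewrite iterS /= exprS -mulrA.
  apply: le_trans (adjoint_bound adj1 T1c _) _.
  have := T1c (iter k S1 u); nra.
have S2c k u : rnorm (iter k S2 u) <= (4 * c2 ^+ 2) ^+ k * rnorm u.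
  elim: k => [|k ih]; first by rewrite expr0 mul1r.
  rewrite iterS /= exprS -mulrA.
  apply: le_trans (adjoint_bound adj2 T2c _) _.
  have := T2c (iter k S2 u); nra.
(* The product of the bounds [4 * c1 ^+ 2] and [4 * c2 ^+ 2] of [S1] and [S2], the factors 4 coming
   from the adjoints. *)
pose q := 16 * c1 ^+ 2 * c2 ^+ 2.
have q0 : 0 <= q by rewrite !mulr_ge0 ?sqr_ge0.
pose M := \sum_(i < n) D * rnorm (x i) * rnorm (y i).
have z_growth k : rnorm (z k) <= M * q ^+ k.
  rewrite mulr_suml; apply: le_trans (rnorm_sum _ _ _) _.
  apply: ler_sum => i _; apply: le_trans (fD _ _) _.
  have -> : q = (4 * c1 ^+ 2) * (4 * c2 ^+ 2) by rewrite /q; ring.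
  rewrite exprMn [leRHS](_ : _ = D * (((4 * c1 ^+ 2) ^+ k * rnorm (x i)) *
    ((4 * c2 ^+ 2) ^+ k * rnorm (y i)))); last by ring.
  by rewrite -mulrA ler_wpM2l// ler_pM ?rnorm_ge0.
have [z0|zn0] := eqVneq (rnorm (z 0%N)) 0.
  have -> : \sum_(i < n) f (x i) (y i) = z 0%N by [].
  by move: G_sq; rewrite z0 !mulr0 mul0r => h; have := rnorm_ge0 G; nra.
have zp : 0 < rnorm (z 0%N) by rewrite lt_neqAle eq_sym zn0 rnorm_ge0.
have z4 : 0 < 4 * rnorm (z 0%N) by rewrite mulr_gt0.
(* Division by [4 * rnorm (z 0)] absorbs the Cauchy-Schwarz factor, so that the sequence satisfies
   exactly the squaring inequality. Then [rnorm G ^+ 2] is at most [16 * q * rnorm (z 0) ^+ 2],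
   whose root is the bound claimed. *)
have z1 : rnorm (z (2 ^ 0)%N) / (4 * rnorm (z 0%N)) <= q.
  apply: (@power_growth _ (fun k => rnorm (z (2 ^ k)%N) / (4 * rnorm (z 0%N)))
      (M / (4 * rnorm (z 0%N)))) => // k.
  - by rewrite divr_ge0 ?rnorm_ge0// ltW.
  - rewrite expr_div_n ler_pdivrMr ?exprn_gt0//.
    rewrite (le_trans (z_sq _))// addnn -mul2n -expnS.
    by rewrite expr2 mulrA divfK ?gt_eqF// mulrC.
  - by rewrite mulrAC ler_pM2r ?invr_gt0.
move: z1; rewrite ler_pdivrMr// expn0 => z1.
rewrite -ler_sqr ?nnegrE ?mulr_ge0 ?rnorm_ge0//.
apply: le_trans G_sq _.
rewrite [leRHS](_ : _ = 4 * rnorm (z 0%N) * (q * (4 * rnorm (z 0%N)))).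
  by rewrite ler_wpM2l// ltW.
by rewrite /q; ring.
Qed.

End TensorOperator.

(** * Finite rank operators and extension from dense subsets *)

Lemma sub_morph_sum (U V : zmodType) (T : U -> V) :
  (forall x y, T (x - y) = T x - T y) ->
  forall n (x : 'I_n -> U), T (\sum_(i < n) x i) = \sum_(i < n) T (x i).
Proof.
move=> TB n x.
have T0 : T 0 = 0 by rewrite -{1}(subrr 0) TB subrr.
have TD u v : T (u + v) = T u + T v.
  by rewrite -[v in LHS]opprK TB -(sub0r v) TB T0 sub0r opprK.
by elim/big_rec2 : _ => // i u v _ <-.
Qed.

Section AdjointLinear.
Context {R : realType} {A : cstarType R} {X : hilbertModType A}.
Implicit Types (x y z w : X) (T F : X -> X).

Lemma hinner_ractl x y (a : A) : hinner (ract x a) y = star a ** hinner x y :> A.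
Proof. by rewrite hinnerC hinner_ract starM -hinnerC. Qed.

Lemma hinner_eq x y : (forall z, hinner x z = hinner y z :> A) -> x = y.
Proof.
move=> xy; apply/eqP; rewrite -subr_eq0; apply/eqP/rnorm0_eq0/eqP.
rewrite -sqrf_eq0 -rnorm_hinner hinnerDl hinnerNl xy subrr.
by rewrite rnorm0.
Qed.

Lemma adjoint_pair_sub T T' x y : adjoint_pair T T' -> T (x - y) = T x - T y.
Proof.
move=> TT'; apply: hinner_eq => z.
by rewrite !(TT', hinnerDl, hinnerNl).
Qed.

Definition finite_rank F := exists (n : nat) (k : 'I_n -> R[i])
  (y y' : 'I_n -> X), forall z, F z = \sum_(i < n) k i *: rank_one (y i) (y' i) z.

Lemma finite_rank_fintype (I : finType) (k : I -> R[i]) (y y' : I -> X) :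
  finite_rank (fun z => \sum_i k i *: rank_one (y i) (y' i) z).
Proof.
exists #|I|, (k \o enum_val), (y \o enum_val), (y' \o enum_val) => z.
rewrite (reindex (@enum_val I predT))//.
exact/onW_bij/enum_val_bij.
Qed.

Lemma finite_rank_adjoint F : finite_rank F -> exists F', adjoint_pair F F'.
Proof.
move=> [n [k [y [y' FE]]]].
exists (fun w => \sum_(i < n) Num.conj (k i) *: rank_one (y' i) (y i) w).
move=> z w; rewrite FE hinner_suml hinner_sumr; apply: eq_bigr => i _.
by rewrite hinnerZl hinnerZr hinner_ractl hinner_ract -hinnerC.
Qed.

Lemma finite_rank_bounded F : finite_rank F ->
  exists2 c : R, 0 <= c & forall z, rnorm (F z) <= c * rnorm z.
Proof.
move=> [n [k [y [y' FE]]]].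
pose c i := complex.Re `|k i| * (rnorm (y i) * (4 * rnorm (y' i))).
have Re0 i : 0 <= complex.Re `|k i|.
  by rewrite normc_def/= sqrtr_ge0.
exists (\sum_(i < n) c i) => [|z].
  by apply: sumr_ge0 => i _; rewrite /c !mulr_ge0 ?rnorm_ge0.
rewrite FE mulr_suml (le_trans (rnorm_sum _ _ _))//; apply: ler_sum => i _.
rewrite rnormZ /c -mulrA ler_wpM2l// (le_trans (rnorm_ract _ _))//.
by rewrite -mulrA ler_wpM2l ?rnorm_ge0// rnorm_hinner_le.
Qed.

Lemma compact_endomorphismP (b : X -> X) : compact_endomorphism b <->
  adjointable b /\ forall e : R, 0 < e ->
    exists2 F, finite_rank F & forall z, rnorm (b z - F z) <= e * rnorm z.
Proof.
split=> -[adj approx]; split=> // e e0.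
  have [|n [k [y [y' FP]]]] := approx e%:C; first by rewrite ltcR.
  exists (fun z => \sum_(i < n) k i *: rank_one (y i) (y' i) z).
    by exists n, k, y, y'.
  by move=> z; have := FP z; rewrite !rnormE -rmorphM/= lecR.
have er : e = (complex.Re e)%:C by rewrite RRe_real// gtr0_real.
have [|F [n [k [y [y' FE]]]] FP] := approx (complex.Re e).
  by rewrite -ltcR -er.
exists n, k, y, y' => z; rewrite -FE er !rnormE -rmorphM/= lecR.
exact: FP.
Qed.

(** The a priori bound [c] provides continuity and leaves no trace in the conclusion. Finite rank
    operators come with an uncontrolled [c], whereas the [K] obtained on elementary sums decays. *)
Lemma dense_le (S : set X) T (c K : R) : dense S ->
  (forall x y, T (x - y) = T x - T y) -> 0 <= K ->
  (forall x, rnorm (T x) <= c * rnorm x) ->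
  (forall x, S x -> rnorm (T x) <= K * rnorm x) ->
  forall x, rnorm (T x) <= K * rnorm x.
Proof.
move=> S_dense TB K0 Tc TK x; apply/ler_addgt0Pr => e e0.
pose d := e / (K + `|c| + 1).
have Kc : 0 < K + `|c| + 1 by have := normr_ge0 c; lra.
have d0 : 0 < d by rewrite divr_gt0.
have [s Ss xs] := dense_rnorm S_dense x d0.
have := rnormD (T s) (T (x - s)); rewrite TB addrCA subrr addr0.
have := TK _ Ss; have := Tc (x - s); rewrite TB.
have := rdistD x s 0; rewrite !subr0 (rdistC s).
have : c * rnorm (x - s) <= `|c| * d.
  apply: le_trans (ler_wpM2r (rnorm_ge0 _) (ler_norm c)) _.
  by rewrite ler_wpM2l// ltW.
have : K * d + `|c| * d <= e.
  by rewrite -mulrDl /d mulrA ler_pdivrMr// mulrC ler_wpM2l ?ltW//; lra.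
nra.
Qed.

Lemma dense_adjoint (S : set X) T (c : R) (u w : X) : dense S ->
  (forall x y, T (x - y) = T x - T y) ->
  (forall x, rnorm (T x) <= c * rnorm x) ->
  (forall x, S x -> hinner (T x) w = hinner x u :> A) ->
  forall x, hinner (T x) w = hinner x u :> A.
Proof.
move=> S_dense TB Tc Tu x; apply/eqP; rewrite -subr_eq0; apply/eqP.
apply: (@rnorm_small0 _ _ _ (4 * `|c| * rnorm w + 4 * rnorm u)) => e e0.
have [s Ss xs] := dense_rnorm S_dense x e0.
have -> : hinner (T x) w - hinner x u =
    hinner (T (x - s)) w - hinner (x - s) u :> A.
  by rewrite TB !hinnerDl !hinnerNl (Tu s)// opprB addrA subrK.
rewrite (le_trans (rnormB _ _))// mulrDl lerD//.
  apply: le_trans (rnorm_hinner_le _ _) _.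
  rewrite [leRHS](_ : _ = 4 * (`|c| * e) * rnorm w); last by ring.
  rewrite ler_wpM2r ?rnorm_ge0// ler_wpM2l// (le_trans (Tc _))//.
  apply: le_trans (ler_wpM2r (rnorm_ge0 _) (ler_norm c)) _.
  by rewrite ler_wpM2l// ltW.
apply: le_trans (rnorm_hinner_le _ _) _.
by rewrite [leRHS]mulrAC ler_wpM2r ?rnorm_ge0// ler_wpM2l// ltW.
Qed.

End AdjointLinear.

(** Fixes a geometric rate and one bound valid for [b] and all approximants, the two inputs that
    make the tensor approximants a geometric Cauchy sequence. *)
Lemma compact_approx (R : realType) (A : cstarType R) (X : hilbertModType A)
    (b : X -> X) : compact_endomorphism b ->
  exists (F : nat -> X -> X) (c : R), [/\ forall n, finite_rank (F n), 0 <= c,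
    forall z, rnorm (b z) <= c * rnorm z,
    forall n z, rnorm (F n z) <= c * rnorm z &
    forall n z, rnorm (b z - F n z) <= 2^-1 ^+ n * rnorm z].
Proof.
move=> /compact_endomorphismP[_ approx].
have half_gt0 n : 0 < 2^-1 ^+ n :> R by rewrite exprn_gt0.
have ex n : exists F : X -> X, finite_rank F /\
    forall z, rnorm (b z - F z) <= 2^-1 ^+ n * rnorm z.
  by have [F ? ?] := approx _ (half_gt0 n); exists F.
have [F FP] := choice ex.
have [c c0 cP] := finite_rank_bounded (FP 0%N).1.
have bc z : rnorm (b z) <= (c + 1) * rnorm z.
  have := rdistD (F 0%N z) (b z) 0; rewrite !subr0.
  have := (FP 0%N).2 z; have := cP z; rewrite expr0; lra.
(* [b] is within 1 of [F 0], hence bounded by [c + 1]; each [F n] is within 1 of [b]. *)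
exists F, (c + 2); split.
- by move=> n; exact: (FP n).1.
- lra.
- move=> z; have := bc z; have := rnorm_ge0 z; lra.
- move=> n z; have := rdistD (b z) (F n z) 0; rewrite !subr0 rdistC.
  have := bc z; have := (FP n).2 z.
  have : 2^-1 ^+ n * rnorm z <= rnorm z.
    by rewrite ler_piMl ?rnorm_ge0// exprn_ile1//; lra.
  lra.
- by move=> n; exact: (FP n).2.
Qed.

(** * The compact operator on the external tensor product *)

Section TensorCompact.
Context {R : realType} {A B AB : cstarType R}.
Context {X1 : hilbertModType A} {X2 : hilbertModType B}.
Context {X : hilbertModType AB} {t : A -> B -> AB} {f : X1 -> X2 -> X}.
Hypothesis t_min : minimal_tensor t.
Hypothesis f_tensor : external_tensor t f.

(** The tensor product of the rank one operators of [u], [u'] and of [v], [v'] is the rank one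
    operator of [f u v], [f u' v'], a formula that makes sense on all of [X]. *)
Lemma finite_rank_tensor (F1 : X1 -> X1) (F2 : X2 -> X2) :
  finite_rank F1 -> finite_rank F2 ->
  exists2 G : X -> X, finite_rank G & forall x y, G (f x y) = f (F1 x) (F2 y).
Proof.
move=> [n [k [u [u' F1E]]]] [m [l [v [v' F2E]]]].
have [f_bil f_ract f_inner _] := f_tensor.
exists (fun z => \sum_(p : 'I_n * 'I_m) (k p.1 * l p.2) *:
    rank_one (f (u p.1) (v p.2)) (f (u' p.1) (v' p.2)) z).
  exact: finite_rank_fintype.
move=> x y; rewrite F1E F2E (bil_suml f_bil).
under [RHS]eq_bigr do rewrite (bil_sumr f_bil).
rewrite pair_bigA/=; apply: eq_bigr => -[i j] _ /=.
by rewrite (bilZl f_bil) (bilZr f_bil) scalerA /rank_one f_inner f_ract.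
Qed.

Lemma tensor_compact (b1 : X1 -> X1) (b2 : X2 -> X2) :
  compact_endomorphism b1 -> self_adjoint b1 ->
  compact_endomorphism b2 -> self_adjoint b2 ->
  exists b : X -> X, [/\ compact_endomorphism b, self_adjoint b,
    exists c : R, forall z, rnorm (b z) <= c * rnorm z,
    forall z w, b (z - w) = b z - b w &
    forall x y, b (f x y) = f (b1 x) (b2 y)].
Proof.
move=> b1_cpt b1_sa b2_cpt b2_sa.
have [f_bil _ f_inner f_dense] := f_tensor.
have [D D0 fD] := tensor_bounded t_min f_tensor.
have [F1 [c1 [F1_fin c1_ge0 b1c F1c b1F1]]] := compact_approx b1_cpt.
have [F2 [c2 [F2_fin c2_ge0 b2c F2c b2F2]]] := compact_approx b2_cpt.
have exG n : exists G : X -> X, finite_rank G /\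
    forall x y, G (f x y) = f (F1 n x) (F2 n y).
  by have [G ? ?] := finite_rank_tensor (F1_fin n) (F2_fin n); exists G.
have [G GP] := choice exG.
have Gf n x y : G n (f x y) = f (F1 n x) (F2 n y) by exact: (GP n).2.
have GB n z w : G n (z - w) = G n z - G n w.
  have [G' adj] := finite_rank_adjoint (GP n).1.
  exact: adjoint_pair_sub adj.
(* On elementary sums the difference splits by changing one factor at a time. Consecutive
   approximants differ by at most [2 * 2^-1 ^+ n], and the factor 16 of the operator estimate makes
   32. *)
have Gdiff n z : rnorm (G n.+1 z - G n z) <=
    (32 * c1 + 32 * c2) * 2^-1 ^+ n * rnorm z.
  have [d d0 dP] := finite_rank_bounded (GP n).1.
  have [d' d'0 d'P] := finite_rank_bounded (GP n.+1).1.
  have half_ge0 : 0 <= 2^-1 ^+ n :> R by rewrite exprn_ge0.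
  apply: (@dense_le _ _ _ _ (fun z => G n.+1 z - G n z) (d' + d) _ f_dense).
  - by move=> x y; rewrite !GB opprD opprK addrACA opprB [- _ + _]addrC.
  - by rewrite !mulr_ge0//; lra.
  - move=> x; rewrite mulrDl (le_trans (rnormB _ _))// lerD//.
  move=> _ [m [x [y [_ ->]]]].
  have FE1 : exists F', adjoint_pair (fun x => F1 n.+1 x - F1 n x) F'.
    have [? h] := finite_rank_adjoint (F1_fin n.+1).
    have [? h'] := finite_rank_adjoint (F1_fin n).
    by eexists; exact: adjoint_pairB h h'.
  have FE2 : exists F', adjoint_pair (fun x => F2 n.+1 x - F2 n x) F'.
    have [? h] := finite_rank_adjoint (F2_fin n.+1).
    have [? h'] := finite_rank_adjoint (F2_fin n).
    by eexists; exact: adjoint_pairB h h'.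
  have [F1' adj1] := FE1; have [F2' adj2] := FE2.
  have [F1'' adj1'] := finite_rank_adjoint (F1_fin n).
  have [F2'' adj2'] := finite_rank_adjoint (F2_fin n.+1).
  have eps1 z' : rnorm (F1 n.+1 z' - F1 n z') <= 2 * 2^-1 ^+ n * rnorm z'.
    rewrite (le_trans (rdistD (b1 z') _ _))// (rdistC _ (b1 _)).
    have := b1F1 n z'; have := b1F1 n.+1 z'; rewrite exprS.
    by have := rnorm_ge0 z'; nra.
  have eps2 z' : rnorm (F2 n.+1 z' - F2 n z') <= 2 * 2^-1 ^+ n * rnorm z'.
    rewrite (le_trans (rdistD (b2 z') _ _))// (rdistC _ (b2 _)).
    have := b2F2 n z'; have := b2F2 n.+1 z'; rewrite exprS.
    by have := rnorm_ge0 z'; nra.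
  have e2 : 0 <= 2 * 2^-1 ^+ n :> R by rewrite mulr_ge0.
  have t1 := tensor_op_le t_min f_tensor x y adj1 adj2' e2 c2_ge0 eps1 (F2c _).
  have t2 := tensor_op_le t_min f_tensor x y adj1' adj2 c1_ge0 e2 (F1c _) eps2.
  rewrite (sub_morph_sum (GB n.+1)) (sub_morph_sum (GB n)) -sumrB.
  rewrite [X in rnorm X](_ : _ =
      \sum_(i < m) f (F1 n.+1 (x i) - F1 n (x i)) (F2 n.+1 (y i)) +
      \sum_(i < m) f (F1 n (x i)) (F2 n.+1 (y i) - F2 n (y i))).
    apply: le_trans (rnormD _ _) _; apply: le_trans (lerD t1 t2) _.
    by rewrite le_eqVlt; apply/orP; left; apply/eqP; ring.
  rewrite -big_split; apply: eq_bigr => i _ /=.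
  by rewrite !Gf (bilBl f_bil) (bilBr f_bil) addrA subrK.
set K := 32 * c1 + 32 * c2 in Gdiff.
(* The error is proportional to [rnorm z]: the pointwise limit is a limit in operator norm, which
   later gives compactness. *)
have lim z : exists l, forall n, rnorm (G n z - l) <= K * 2 * rnorm z * 2^-1 ^+ n.
  have [|l lP] := @geometric_cvg _ X (fun n => G n z) (K * rnorm z).
    by move=> n; rewrite mulrAC.
  by exists l => n; rewrite [K * 2 * _]mulrAC.
have [b bP] := choice lim.
have K0 : 0 <= K by rewrite /K; lra.
have bB z w : b (z - w) = b z - b w.
  apply/eqP; rewrite -subr_eq0; apply/eqP.
  apply: (@rnorm_small0 _ _ _ (K * 2 * rnorm (z - w) +
    (K * 2 * rnorm z + K * 2 * rnorm w))).
  move=> e e0; have [n nP] := exists_half_exp 1 e0.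
  rewrite mul1r in nP.
  have le_e (h : X) : K * 2 * rnorm h * 2^-1 ^+ n <= K * 2 * rnorm h * e.
    by rewrite ler_wpM2l ?mulr_ge0 ?rnorm_ge0// ltW.
  rewrite (le_trans (rdistD (G n (z - w)) _ _))// mulrDl lerD//.
    by rewrite rdistC (le_trans (bP _ _)).
  rewrite GB [X in rnorm X](_ : _ = (G n z - b z) - (G n w - b w)).
    rewrite (le_trans (rnormB _ _))// mulrDl.
    by rewrite lerD// (le_trans (bP _ _)).
  by rewrite opprD opprK addrACA opprB [- _ + _]addrC.
have [cb b_bounded] : exists c : R, forall z, rnorm (b z) <= c * rnorm z.
  have [d d0 dP] := finite_rank_bounded (GP 0%N).1.
  exists (d + K * 2) => z; have := rdistD (G 0%N z) (b z) 0; rewrite !subr0.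
  by rewrite rdistC; have := bP z 0%N; have := dP z; rewrite expr0; lra.
have bf x y : b (f x y) = f (b1 x) (b2 y).
  apply/eqP; rewrite -subr_eq0; apply/eqP.
  apply: (@rnorm_small0 _ _ _ (K * 2 * rnorm (f x y) +
    (D * c1 * rnorm x * rnorm y + D * c2 * rnorm x * rnorm y))).
  move=> e e0; have [n nP] := exists_half_exp 1 e0.
  rewrite mul1r in nP.
  rewrite (le_trans (rdistD (G n (f x y)) _ _))// mulrDl lerD//.
    rewrite rdistC (le_trans (bP _ _))// ler_wpM2l ?mulr_ge0 ?rnorm_ge0//.
    exact: ltW.
  rewrite Gf (le_trans (rdistD (f (F1 n x) (b2 y)) _ _))// mulrDl lerD//.
    rewrite -(bilBr f_bil) (le_trans (fD _ _))// rdistC.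
    rewrite -!mulrA ler_wpM2l// !mulrA.
    rewrite -(mulrA (c1 * _)) ler_pM ?rnorm_ge0//.
    by rewrite (le_trans (b2F2 _ _))// mulrC ler_wpM2l ?rnorm_ge0// ltW.
  rewrite -(bilBl f_bil) (le_trans (fD _ _))// rdistC.
  rewrite [leRHS](_ : _ = D * (e * rnorm x) * (c2 * rnorm y)); last by ring.
  rewrite ler_pM ?mulr_ge0 ?rnorm_ge0// ler_wpM2l//.
  by rewrite (le_trans (b1F1 _ _))// ler_wpM2r ?rnorm_ge0// ltW.
have b_sa : self_adjoint b.
  move=> z w; move: z.
  apply: (dense_adjoint f_dense bB b_bounded) => _ [m [x [y [_ ->]]]].
  rewrite [RHS]hinnerC; set z := \sum_(i < m) _.
  (* With [z] already an elementary sum, conjugate symmetry exchanges the roles, and the same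
     density argument reduces [w]. *)
  suff -> : hinner (b w) z = hinner w (b z) :> AB by rewrite -hinnerC.
  move: w; apply: (dense_adjoint f_dense bB b_bounded) => _ [n [u [v [_ ->]]]].
  rewrite !(sub_morph_sum bB) !hinner_suml; apply: eq_bigr => i _.
  rewrite !hinner_sumr; apply: eq_bigr => j _.
  by rewrite !bf !f_inner b1_sa b2_sa.
exists b; split=> //; last by exists cb.
apply/compact_endomorphismP; split; first by exists b.
move=> e e0; have [n nP] := exists_half_exp (K * 2) e0.
exists (G n); first exact: (GP n).1.
move=> z; rewrite rdistC (le_trans (bP z n))// mulrAC ler_wpM2r ?rnorm_ge0//.
exact: ltW.
Qed.

End TensorCompact.

(** * Submodules of the external tensor product *)

(** The whole algebra is hereditary in itself, so it has a sequential approximate unit. With c the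
    square of [x] and [u] self-adjoint of norm at most 1, the square of [x - ract x u] is (c - uc) -
    (c - uc)u, of norm at most twice that of c - uc. *)
Lemma approximate_unit (R : realType) (A : cstarType R) (X : hilbertModType A) :
  hereditary_sigma_unital A -> forall (x : X) (e : R), 0 < e ->
  exists u : A, rnorm (x - ract x u) < e.
Proof.
move=> su x e e0.
have setT_hereditary : @hereditary R A setT.
  by split=> //; split=> //; exact: closedT.
have [u [u_pos u1 _ u_cvg]] := su _ setT_hereditary.
pose c : A := hinner x x; pose d := e ^+ 2 / 4.
have d0 : 0 < d by rewrite divr_gt0// exprn_gt0.
have /(u_cvg c I)[N _ /(_ N (leqnn N))] : nbhs c [set y | rnorm (c - y) < d].
  by apply/nbhs_rnorm; exists d.
rewrite /= => cu; exists (u N).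
rewrite -ltr_sqr ?nnegrE ?rnorm_ge0 ?ltW// -rnorm_hinner.
have u_le1 : rnorm (u N) <= 1 by rewrite -lecR -rnormE.
have h : hinner (x - ract x (u N)) x = c - u N ** c :> A.
  by rewrite hinnerDl hinnerNl hinner_ractl (positive_star (u_pos N).2).
rewrite hinnerDr hinnerNr hinner_ract h.
apply: le_lt_trans (rnormB _ _) _.
have := rnorm_amul (c - u N ** c) (u N).
have := rnorm_ge0 (c - u N ** c); rewrite /d in cu; nra.
Qed.

Section TensorSpan.
Context {K : comNzRingType} {U V W : lmodType K} {f : U -> V -> W}.
Hypothesis f_bil : bilinear_for *:%R *:%R f.
Context {S : set U} {T : set V}.

Lemma tensor_span_fintype (I : finType) (u : I -> U) (v : I -> V) :
  (forall i, S (u i) /\ T (v i)) -> tensor_span f S T (\sum_i f (u i) (v i)).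
Proof.
move=> uv; exists #|I|, (u \o enum_val), (v \o enum_val); split=> [i|].
  exact: uv.
rewrite (reindex (@enum_val I predT))//.
exact/onW_bij/enum_val_bij.
Qed.

Lemma tensor_span0 : tensor_span f S T 0.
Proof.
exists 0%N, (fun=> 0), (fun=> 0); split=> [[]//|].
by rewrite big_ord0.
Qed.

Lemma tensor_span1 u v : S u -> T v -> tensor_span f S T (f u v).
Proof. by exists 1%N, (fun=> u), (fun=> v); rewrite big_ord1. Qed.

Lemma tensor_spanD w w' : tensor_span f S T w -> tensor_span f S T w' ->
  tensor_span f S T (w + w').
Proof.
move=> [n [u [v [uv ->]]]] [m [u' [v' [uv' ->]]]].
pose p (i : 'I_n + 'I_m) := match i with inl j => u j | inr j => u' j end.
pose q (i : 'I_n + 'I_m) := match i with inl j => v j | inr j => v' j end.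
rewrite [X in tensor_span _ _ _ X](_ : _ = \sum_i f (p i) (q i)).
  by apply: tensor_span_fintype => -[].
by rewrite big_sumType.
Qed.

Lemma tensor_span_sum (I : Type) (r : seq I) (w : I -> W) :
  (forall i, tensor_span f S T (w i)) ->
  tensor_span f S T (\sum_(i <- r) w i).
Proof.
move=> w_span; elim/big_ind : _ => //.
- exact: tensor_span0.
- exact: tensor_spanD.
Qed.

Lemma tensor_spanZ k w : (forall k u, S u -> S (k *: u)) ->
  tensor_span f S T w -> tensor_span f S T (k *: w).
Proof.
move=> SZ [n [u [v [uv ->]]]]; rewrite scaler_sumr.
apply: tensor_span_sum => i; rewrite -(bilZl f_bil).
by apply: tensor_span1; [exact/SZ/(uv i).1|exact: (uv i).2].
Qed.

End TensorSpan.

Section HilbertSubmodules.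
Context {R : realType} {A : cstarType R} {X : hilbertModType A}.

Lemma ract_sumr (x : X) (I : Type) (r : seq I) (c : I -> A) :
  ract x (\sum_(i <- r) c i) = \sum_(i <- r) ract x (c i).
Proof.
have ract0 : ract x (0 : A) = 0.
  by have := ractZr (0 : R[i]) x (0 : A); rewrite !scale0r.
by elim/big_rec2 : _ => // i u v _ <-; rewrite ractDr.
Qed.

Lemma ract_suml (a : A) (I : Type) (r : seq I) (x : I -> X) :
  ract (\sum_(i <- r) x i) a = \sum_(i <- r) ract (x i) a.
Proof.
have ract0 : ract (0 : X) a = 0.
  by have := ractZl (0 : R[i]) (0 : X) a; rewrite !scale0r.
by elim/big_rec2 : _ => // i u v _ <-; rewrite ractDl.
Qed.

Lemma hilbert_submoduleI (I : Type) (Z : I -> set X) :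
  (forall i, hilbert_submodule (Z i)) ->
  hilbert_submodule [set x | forall i, Z i x].
Proof.
move=> ZP; split=> /=.
- apply/closed_rnorm => x xP i; have [/closed_rnorm Zi _ _ _] := ZP i.
  by apply: Zi => e /xP[s Zs xs]; exists s.
- split=> [i|x x' Zx Zx' i]; have [_ [Z0 ZD] _ _] := ZP i => //.
  exact: ZD.
- by move=> k x Zx i; have [_ _ ZZ _] := ZP i; exact: ZZ.
- by move=> x a Zx i; have [_ _ _ ZA] := ZP i; exact: ZA.
Qed.

End HilbertSubmodules.

Section TensorSubmodule.
Context {R : realType} {A B AB : cstarType R}.
Context {X1 : hilbertModType A} {X2 : hilbertModType B}.
Context {X : hilbertModType AB} {t : A -> B -> AB} {f : X1 -> X2 -> X}.
Hypothesis t_min : minimal_tensor t.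
Hypothesis f_tensor : external_tensor t f.

Lemma hilbert_submodule_tensor (Y1 : set X1) (Y2 : set X2) :
  hilbert_submodule Y1 -> hilbert_submodule Y2 ->
  hilbert_submodule (tensor_submodule f Y1 Y2).
Proof.
move=> [_ [Y10 Y1D] Y1Z Y1A] [_ [Y20 Y2D] Y2Z Y2B].
have [f_bil f_ract _ _] := f_tensor.
have [_ _ _ t_dense _] := t_min.
split; first exact: closed_closure.
- split; first exact/subset_closure/tensor_span0.
  move=> x y /closure_rnorm xP /closure_rnorm yP; apply/closure_rnorm => e e0.
  have [s Ss xs] := xP _ (divr_gt0 e0 (ltr0n _ 2)).
  have [s' Ss' ys] := yP _ (divr_gt0 e0 (ltr0n _ 2)).
  exists (s + s'); first exact: tensor_spanD.
  by rewrite opprD addrACA; have := rnormD (x - s) (y - s'); lra.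
- move=> k x /closure_rnorm xP; apply/closure_rnorm => e e0.
  pose r := complex.Re `|k| + 1.
  have k0 : 0 <= complex.Re `|k| by rewrite normc_def/= sqrtr_ge0.
  have r0 : 0 < r by rewrite /r; lra.
  have [s Ss xs] := xP _ (divr_gt0 e0 r0).
  exists (k *: s); first exact: tensor_spanZ.
  rewrite -scalerBr rnormZ; move: xs; rewrite ltr_pdivlMr//.
  by rewrite /r; have := rnorm_ge0 (x - s); nra.
- move=> x c /closure_rnorm xP; apply/closure_rnorm => e e0.
  have c1 : 0 < rnorm c + 1 by have := rnorm_ge0 c; lra.
  have [s Ss xs] := xP _ (divr_gt0 e0 (mulr_gt0 (ltr0n _ 2) c1)).
  have s1 : 0 < rnorm s + 1 by have := rnorm_ge0 s; lra.
  (* The span is only stable under sums of elements [t a b], so [c] is approximated as well, to a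
     precision that depends on the [s] already chosen. *)
  have [d [n [a [b [_ dE]]]] cd] :=
    dense_rnorm t_dense c (divr_gt0 e0 (mulr_gt0 (ltr0n _ 2) s1)).
  exists (ract s d).
    have [m [u [v [uv ->]]]] := Ss; rewrite dE ract_suml.
    apply: tensor_span_sum => i; rewrite ract_sumr.
    apply: tensor_span_sum => j; rewrite f_ract.
    by apply: tensor_span1; [exact/Y1A/(uv i).1|exact/Y2B/(uv i).2].
  apply: le_lt_trans (rdistD (ract s c) _ _) _.
  rewrite -ractBl -ractBr.
  have := rnorm_ract (x - s) c; have := rnorm_ract s (c - d).
  move: xs cd; rewrite !ltr_pdivlMr ?mulr_gt0//.
  have := rnorm_ge0 (x - s); have := rnorm_ge0 (c - d).
  have := rnorm_ge0 s; have := rnorm_ge0 c; lra.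
Qed.

Hypothesis suA : hereditary_sigma_unital A.
Hypothesis suB : hereditary_sigma_unital B.

(** The delicate point is the action of [A], since [AB] does not act on one factor alone:
    [f (ract x a) y] is the limit of [f x y] acted on by [t a u], with [u] such that [ract y u]
    approaches [y]. *)
Lemma submodule_slice_l (Z : set X) (y : X2) : hilbert_submodule Z ->
  hilbert_submodule [set x | Z (f x y)].
Proof.
move=> [/closed_rnorm Z_closed [Z0 ZD] ZZ ZA].
have [f_bil f_ract _ _] := f_tensor.
have [D D0 fD] := tensor_bounded t_min f_tensor.
have Dy : 0 < D * rnorm y + 1 by have := rnorm_ge0 y; nra.
split=> /=.
- apply/closed_rnorm => x xP; apply: Z_closed => e e0.
  have [s Zs xs] := xP _ (divr_gt0 e0 Dy).
  exists (f s y) => //; rewrite -(bilBl f_bil) (le_lt_trans (fD _ _))//.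
  by move: xs; rewrite ltr_pdivlMr//; have := rnorm_ge0 (x - s); lra.
- split; first by rewrite (bil0l f_bil).
  by move=> x x'; rewrite (bilDl f_bil); exact: ZD.
- by move=> k x; rewrite (bilZl f_bil); exact: ZZ.
- move=> x a Zx; apply: Z_closed => e e0.
  have Dx : 0 < D * rnorm (ract x a) + 1 by have := rnorm_ge0 (ract x a); nra.
  have [u yu] := approximate_unit suB y (divr_gt0 e0 Dx).
  exists (f (ract x a) (ract y u)); first by rewrite -f_ract; exact: ZA.
  rewrite -(bilBr f_bil) (le_lt_trans (fD _ _))//.
  by move: yu; rewrite ltr_pdivlMr//; have := rnorm_ge0 (y - ract y u); lra.
Qed.

Lemma submodule_slice_r (Z : set X) (x : X1) : hilbert_submodule Z ->
  hilbert_submodule [set y | Z (f x y)].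
Proof.
move=> [/closed_rnorm Z_closed [Z0 ZD] ZZ ZA].
have [f_bil f_ract _ _] := f_tensor.
have [D D0 fD] := tensor_bounded t_min f_tensor.
have Dx : 0 < D * rnorm x + 1 by have := rnorm_ge0 x; nra.
split=> /=.
- apply/closed_rnorm => y yP; apply: Z_closed => e e0.
  have [s Zs ys] := yP _ (divr_gt0 e0 Dx).
  exists (f x s) => //; rewrite -(bilBr f_bil) (le_lt_trans (fD _ _))//.
  by move: ys; rewrite ltr_pdivlMr//; have := rnorm_ge0 (y - s); lra.
- split; first by rewrite (bil0r f_bil).
  by move=> y y'; rewrite (bilDr f_bil); exact: ZD.
- by move=> k y; rewrite (bilZr f_bil); exact: ZZ.
- move=> y b Zy; apply: Z_closed => e e0.
  have Dy : 0 < D * rnorm (ract y b) + 1 by have := rnorm_ge0 (ract y b); nra.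
  have [u xu] := approximate_unit suA x (divr_gt0 e0 Dy).
  exists (f (ract x u) (ract y b)); first by rewrite -f_ract; exact: ZA.
  rewrite -(bilBl f_bil) (le_lt_trans (fD _ _))//.
  by move: xu; rewrite ltr_pdivlMr//; have := rnorm_ge0 (x - ract x u); lra.
Qed.

(** Minimality is used one factor at a time: slices at the generators of [Y2] capture all of [Y1],
    then slices at the elements of [Y1] capture all of [Y2]. *)
Lemma countably_generated_tensor (Y1 : set X1) (Y2 : set X2) :
  countably_generated Y1 -> countably_generated Y2 ->
  countably_generated (tensor_submodule f Y1 Y2).
Proof.
move=> [x [xY1 Y1_min]] [y [yY2 Y2_min]].
pose g (p : nat * nat) := f (x p.1) (y p.2).
(* Numbers that encode no pair repeat the generator of index [(0, 0)]. *)
exists (fun n => g (odflt (0%N, 0%N) (unpickle n))); split.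
  move=> _ [n _ <-]; apply/subset_closure/tensor_span1.
    by apply: xY1; exists (odflt (0%N, 0%N) (unpickle n)).1.
  by apply: yY2; exists (odflt (0%N, 0%N) (unpickle n)).2.
move=> Z Z_sub gZ; have [/closed_rnorm Z_closed [Z0 ZD] ZZ ZA] := Z_sub.
have xyZ n m : Z (f (x n) (y m)).
  by apply: gZ; exists (pickle (n, m)); rewrite // pickleK.
have Y1Z u : Y1 u -> forall m, Z (f u (y m)).
  apply: (Y1_min [set u | forall m, Z (f u (y m))]).
    by apply: hilbert_submoduleI => m; exact: submodule_slice_l.
  by move=> _ [n _ <-] m; exact: xyZ.
have Y12Z u v : Y1 u -> Y2 v -> Z (f u v).
  move=> Y1u; apply: (Y2_min [set v | Z (f u v)]).
    exact: submodule_slice_r.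
  by move=> _ [m _ <-]; exact: Y1Z.
move=> z /closure_rnorm zP; apply: Z_closed => e /zP[s [n [u [v [uv ->]]]] zs].
exists (\sum_(i < n) f (u i) (v i)) => //.
elim/big_ind : _ => // i _; exact: Y12Z (uv i).1 (uv i).2.
Qed.

End TensorSubmodule.

Theorem theorem4p1 (R : realType) (A B : cstarType R)
  (srA : stable_rank_one A) (srB : stable_rank_one B)
  (suA : hereditary_sigma_unital A) (suB : hereditary_sigma_unital B)
  (AB : cstarType R) (t : A -> B -> AB) (t_min : minimal_tensor t)
  (X1 : hilbertModType A) (X2 : hilbertModType B)
  (X : hilbertModType AB) (f : X1 -> X2 -> X)
  (f_tensor : external_tensor t f)
  (Y1 : set X1) (Y2 : set X2)
  (X1_cg : countably_generated [set: X1])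
  (X2_cg : countably_generated [set: X2])
  (Y1_cg : countably_generated Y1) (Y2_cg : countably_generated Y2) :
  compactly_contained Y1 -> compactly_contained Y2 ->
  compactly_contained (tensor_submodule f Y1 Y2).
Proof.
move=> [Y1_sub _ _ [b1 [b1_cpt b1_sa b1_id]]] [Y2_sub _ _ [b2 [b2_cpt b2_sa b2_id]]].
have [_ _ _ f_dense] := f_tensor.
split.
- exact: (hilbert_submodule_tensor t_min f_tensor).
- exact: (countably_generated_tensor t_min f_tensor).
(* By density the ambient module is itself a tensor submodule, so its countable generation is an
   instance of the same lemma. *)
- have <- : tensor_submodule f [set: X1] [set: X2] = [set: X].
    rewrite -subTset => x _; apply/closure_rnorm => e.
    exact: (dense_rnorm f_dense).
  exact: (countably_generated_tensor t_min f_tensor).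
have [b [b_cpt b_sa [c b_bounded] bB bf]] :=
  tensor_compact t_min f_tensor b1_cpt b1_sa b2_cpt b2_sa.
exists b; split=> // x /closure_rnorm xP.
apply/eqP; rewrite -subr_eq0; apply/eqP.
apply: (@rnorm_small0 _ _ _ (`|c| + 1)) => e e0.
have [s [n [u [v [uv sE]]]] xs] := xP _ e0.
(* Elementary sums from [Y1] and [Y2] are fixed exactly; boundedness of [b] carries this to the
   closure. *)
have bs : b s = s.
  rewrite sE (sub_morph_sum bB); apply: eq_bigr => i _.
  by rewrite bf b1_id ?b2_id//; have [] := uv i.
rewrite (le_trans (rdistD (b s) _ _))// mulrDl mul1r -bB lerD//.
  apply: le_trans (b_bounded _) _.
  apply: le_trans (ler_wpM2r (rnorm_ge0 _) (ler_norm c)) _.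
  by rewrite ler_wpM2l// ltW.
by rewrite bs rdistC ltW.
Qed.
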